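(* Let $G$ be an amenable unimodular lcsc group with Haar measure $m_G$. Assume that - $\Lambda$ is a weighted Delone set in $G$ with hull $\mathcal H_\Lambda$; - $(T_m)$ is a strong Følner exhaustion sequence in $G$; - $\Lambda$ is almost tempered repetitive with respect to $(T_m)$; - $w$ is an admissible weight function on $G$ over $\mathcal H_\Lambda$. Then there exists $I_w\in\mathbb R$, depending on $\Lambda$ and $w$ but independent of $(T_m)$ (i.e. the same number works for every strong Følner exhaustion sequence $(T_m)$ in $G$ with respect to which $\Lambda$ is almost tempered repetitive), such that $$\lim_{m\to\infty}\sup_{\Pi\in\mathcal H_\Lambda}\left|\frac{w(T_m,\Pi)}{m_G(T_m)}-I_w\right|=0.$$
   Context: lcsc = locally compact second countable; $e$ is the identity. A subset $P\subseteq G$ is Delone if there are a nonempty open relatively compact $U\subseteq G$ with $\#(gU\cap P)\le 1$ for all $g\in G$ and a compact $K\subseteq G$ with $PK=G$. A weighted Delone set is a pair $\Lambda=(P,\alpha)$ with $P$ Delone and $\alpha:P\to[\sigma^{-1},\sigma]$ for some $\sigma\ge1$; it is identified with the Radon measure $\delta_\Lambda=\sum_{x\in P}\alpha(x)\delta_x$. $G$ acts by $g.(P,\alpha)=(gP,\alpha(g^{-1}\,\cdot))$. The hull $\mathcal H_\Lambda$ is the closure of $\{g.\Lambda:g\in G\}$ in the space of Radon measures with the weak-$*$ topology (tested against $C_c(G)$); it is compact, consists of (Dirac combs of) weighted Delone sets, and $G$ acts on it jointly continuously. Fix a continuous adapted metric $d$ on $G$ (left-invariant, proper, i.e. balls are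 relatively compact, and locally bounded; one always exists) with open balls $B_\delta(y)$. For relatively compact $S\subseteq G$ and Radon measures $\mu,\nu$ put $d_S(\mu,\nu)=\inf\{\delta>0: |\mu(B_\delta(y))-\nu(B_\delta(y))|<\delta\ \text{for all } y\in S\cap(\operatorname{supp}\mu\cup\operatorname{supp}\nu)\}$, and $d_S(\Pi,\Phi)=d_S(\delta_\Pi,\delta_\Phi)$ for weighted Delone sets. The $S$-patch of $\Lambda$ is $(\delta_\Lambda|_S,S)$; patches are equivalent if one is a translate $(g_*\mu,gS)$ of the other $(\mu,S)$; a pattern of size $S$ is the equivalence class of a patch whose support is a translate of $S$. For $\delta>0$ the pattern of a patch $(\mu,S)$ $\delta$-occurs in $T$ if there is $g\in G$ with $gS\subseteq T$ and $d_{gS}(g_*\mu,\delta_\Lambda|_{gS})<\delta$. For relatively compact $L,S$ put $\partial_L(S)=\{g\in G: Lg\cap S\ne\emptyset \text{ and } Lg\cap(G\setminus S)\neq\emptyset\}$. A strong Følner exhaustion sequence is a sequence $\mathcal T=(T_m)_{m\in\mathbb N}$ of compact sets of positive Haar measure which is a Følner sequence ($m_G(T_m\triangle KT_m)/m_G(T_m)\to0$ for all nonempty compact $K$), satisfies $m_G(\partial_K(T_m))/m_G(T_m)\to0$ for all compact $K$, and satisfies $e\in T_m\subseteq\mathring T_{m+1}$ and $\bigcup_mT_m=G$. For $\delta>0$, $m\in\mathbb N$ let $\mathcal R^{\mathcal T}_\Lambda(\delta,m)\in\mathbb N\cup\{\infty\}$ be the infimum of all $n\in\mathbb N$ such that every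 pattern of $\Lambda$ of size $\mathring T_m^{-1}$ $\delta$-occurs in $h\mathring T_n^{-1}$ for all $h\in G$ ($\inf\emptyset=\infty$). Put $\zeta(\delta)=\inf_{m} m_G(T_m)/m_G(T_{\mathcal R^{\mathcal T}_\Lambda(\delta,m)})$, with $\zeta(\delta)=0$ if $\mathcal R^{\mathcal T}_\Lambda(\delta,m)=\infty$ for some $m$. $\Lambda$ is almost tempered repetitive with respect to $\mathcal T$ if $\zeta(\delta)>0$ for all $\delta\in(0,1)$. Let $\mathcal{RK}(G)$ be the set of relatively compact (Borel) subsets of $G$. A function $w:\mathcal{RK}(G)\times\mathcal H_\Lambda\to\mathbb R$ is an admissible weight function over $\mathcal H_\Lambda$ if: (W1) $w(\emptyset,x)=0$ for all $x$. (W2) There are a compact $J\subseteq G$ and $\eta>0$ with $|w(L,x)-w(K,x)|\le\eta\,(m_G(L\setminus K)+m_G(\partial_J(L))+m_G(\partial_J(K)))$ for all $x$ and all $K\subseteq L$ in $\mathcal{RK}(G)$. (W3) There are a compact $B\subseteq G$ and $\theta\ge0$ such that for all finite families of pairwise disjoint $K_i\in\mathcal{RK}(G)$ and all $x$: $w(\bigsqcup_iK_i,x)\le\sum_iw(K_i,x)+\theta\sum_im_G(\partial_B(K_i))$. (W4) There are a compact $I\subseteq G$ and $\vartheta\ge0$ with $|w(K,x)-w(Kh^{-1},hx)|\le\vartheta\,m_G(\partial_I(K))$ for all $x$, $K\in\mathcal{RK}(G)$, $h\in G$. (W5) For every strong Følner exhaustion sequence $(T_m)$ and every $\varepsilon>0$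 there are $\delta>0$ and $m_0\in\mathbb N$ such that for all $m\ge m_0$ and all $\Pi,\Phi\in\mathcal H_\Lambda$: $d_{T_m^{-1}}(\Pi,\Phi)\le\delta$ implies $|w(T_m,\Phi)-w(T_m,\Pi)|\le\varepsilon\,m_G(T_m)$. *)

(* Defs.v *)
From HB Require Import structures.
From mathcomp Require Import all_boot all_order all_algebra.
From mathcomp Require Import finmap.
From mathcomp Require Import all_classical all_reals all_analysis.

Set Implicit Arguments.
Unset Strict Implicit.
Unset Printing Implicit Defensive.

Import Order.TTheory GRing.Theory Num.Theory.
Import numFieldNormedType.Exports.

Local Open Scope classical_set_scope.
Local Open Scope ring_scope.

(* The base point plays no role; g_sigma_algebraType asks for one. *)
HB.structure Definition PreTopologicalGroup :=
  {G of PointedTopological G & Group G}.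

HB.mixin Record PreTopologicalGroup_isTopologicalGroup G
    & PreTopologicalGroup G := {
  mulg_continuous : continuous (fun x : G * G => (x.1 * x.2)%g) ;
  invg_continuous : continuous (fun x : G => (x^-1)%g)
}.

#[short(type="topologicalGroupType")]
HB.structure Definition TopologicalGroup :=
  {G of PreTopologicalGroup G & PreTopologicalGroup_isTopologicalGroup G}.

Definition lcsc (G : topologicalGroupType) : Prop :=
  [/\ hausdorff_space G, locally_compact [set: G] & @second_countable G].

Section set_operations.
Variable G : topologicalGroupType.
Implicit Types (g : G) (A B : set G).

Definition lmul g A : set G := [set (g * x)%g | x in A].
Definition rmul A g : set G := [set (x * g)%g | x in A].
Definition prodset A B : set G := [set (x * y)%g | x in A & y in B].
Definition invset A : set G := [set (x^-1)%g | x in A].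

Definition Kboundary (L S : set G) : set G :=
  [set g | rmul L g `&` S !=set0 /\ rmul L g `&` ~` S !=set0].

Lemma lmulg_continuous g : continuous (fun x : G => (g * x)%g).
Proof.
move=> x; apply: (@continuous2_cvg G G G G (nbhs x) _ (fun=> g) id
    (fun y z => (y * z)%g)); [exact: (@mulg_continuous G (g, x))|exact: cvg_cst|exact: cvg_id].
Qed.

Lemma lmulE g A : lmul g A = (fun x => (g^-1 * x)%g) @^-1` A.
Proof.
apply/seteqP; split=> [_ [x Ax <-]|x /= Ax]; first by rewrite /= mulKg.
by exists (g^-1 * x)%g; rewrite ?mulVKg.
Qed.

End set_operations.

Section borel.
Variable X : ptopologicalType.

Definition borel := g_sigma_algebraType (@open X).

HB.instance Definition _ := Measurable.on borel.

Definition borel_set (A : set X) : Prop := measurable (A : set borel).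

End borel.

Section radon_measure.
Variables (R : realType) (X : ptopologicalType).

(* A locally finite Borel measure is automatically regular on an lcsc space.
   MathComp measures are functions on all sets, unconstrained off the
   sigma-algebra; radon_nonborel makes equality of Radon measures coincide
   with equality on Borel sets, see radonP. *)
Record radonMeasure := RadonMeasure {
  radon_measure :> {measure set (borel X) -> \bar R} ;
  radon_compact : forall K : set X, compact K -> (radon_measure K < +oo)%E ;
  radon_nonborel : forall A : set X, ~ borel_set A -> radon_measure A = 0%E
}.

Lemma radonP (mu nu : radonMeasure) :
  (forall A : set X, borel_set A -> mu A = nu A) -> mu = nu.
Proof.
case: mu nu => [[m [[m0 mA] [mS]]] mc mn] [[n [[n0 nA] [nS]]] nc nn] /= mnE.
have mn_eq : m = n.
  apply/funext => A; have [bA|nbA] := pselect (borel_set A); first exact: mnE.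
  by rewrite [LHS]mn// [RHS]nn.
subst n.
rewrite (Prop_irrelevance n0 m0) (Prop_irrelevance nA mA) in nS nc nn *.
rewrite (Prop_irrelevance nS mS) in nc nn *.
by congr RadonMeasure; exact: Prop_irrelevance.
Qed.

Lemma borel_open (A : set X) : open A -> borel_set A.
Proof. by move=> oA; exact: sub_sigma_algebra. Qed.

HB.instance Definition _ := gen_eqMixin radonMeasure.
HB.instance Definition _ := gen_choiceMixin radonMeasure.

Definition Cc : set (X -> R) :=
  [set f | continuous f /\ compact (closure [set x | f x != 0])].

Definition radon_eval (mu : radonMeasure) : {ptws set_type Cc -> R} :=
  fun f => (\int[mu]_x (set_val f : X -> R) x)%R.

(* The weak-* topology against C_c(X). *)
HB.instance Definition _ :=
  Topological.copy radonMeasure (initial_topology radon_eval).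

Definition msupp (mu : set X -> \bar R) : set X :=
  [set x | forall U : set X, open U -> U x -> (0 < mu U)%E].

End radon_measure.

Section radon_action.
Variables (R : realType) (G : topologicalGroupType).

Lemma measurable_lmulg (g : G) :
  measurable_fun [set: borel G] (fun x : borel G => (g * x)%g : borel G).
Proof.
apply: (@measurability _ _ (borel G) (borel G) _ _ (@open G)) => // _ [U oU <-].
rewrite setTI; apply: borel_open.
by apply: open_comp => // x _; exact: lmulg_continuous.
Qed.

Lemma borel_lmulg (g : G) (A : set G) :
  borel_set A -> borel_set ((fun x => (g * x)%g) @^-1` A).
Proof.
by move=> bA; rewrite /borel_set -[X in measurable X]setTI; exact: measurable_lmulg.
Qed.

(* The push-forward of mu under x |-> g * x. *)
Definition lpush (g : G) (mu : set (borel G) -> \bar R) : set (borel G) -> \bar R :=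
  fun A => mu ((fun x => (g * x)%g) @^-1` A).

Section lpush_measure.
Variables (g : G) (mu : {measure set (borel G) -> \bar R}).

Let lpush0 : lpush g mu set0 = 0%E.
Proof. rewrite /lpush preimage_set0; exact: measure0. Qed.

Let lpush_ge0 A : (0 <= lpush g mu A)%E.
Proof. exact: (measure_ge0 mu). Qed.

Let lpush_sigma_additive : semi_sigma_additive (lpush g mu).
Proof.
move=> F mF tF mUF; rewrite /lpush preimage_bigcup.
apply: measure_semi_sigma_additive.
- by move=> n; exact: (borel_lmulg g (mF n)).
- apply/trivIsetP => /= i j _ _ ij; rewrite -preimage_setI.
  by move/trivIsetP : tF => /(_ _ _ _ _ ij) ->//; rewrite preimage_set0.
- by rewrite -preimage_bigcup; exact: (borel_lmulg g mUF).
Qed.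

HB.instance Definition _ := isMeasure.Build _ (borel G) R (lpush g mu)
  lpush0 lpush_ge0 lpush_sigma_additive.

End lpush_measure.

Let lpush_compact (g : G) (mu : radonMeasure R G) (K : set G) :
  compact K -> (lpush g mu K < +oo)%E.
Proof.
move=> cK; rewrite /lpush; apply: radon_compact.
have -> : (fun x => (g * x)%g) @^-1` K = lmul (g^-1)%g K.
  by rewrite lmulE invgK.
apply: continuous_compact => //; apply: continuous_subspaceT.
exact: lmulg_continuous.
Qed.

Let lpush_nonborel (g : G) (mu : radonMeasure R G) (A : set G) :
  ~ borel_set A -> lpush g mu A = 0%E.
Proof.
move=> nbA; rewrite /lpush; apply: radon_nonborel.
apply: contra_not nbA => /(@borel_lmulg (g^-1)%g).
rewrite (_ : _ @^-1` _ = A)//.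
by apply/seteqP; split => x /=; rewrite mulVKg.
Qed.

Definition radon_act (g : G) (mu : radonMeasure R G) : radonMeasure R G :=
  @RadonMeasure R G (lpush g mu) (@lpush_compact g mu)
    (@lpush_nonborel g mu).

End radon_action.

Section delone.
Variables (R : realType) (G : topologicalGroupType).

Definition delone (P : set G) : Prop :=
  (exists U : set G, [/\ U !=set0, open U, precompact U &
     forall g, is_subset1 (lmul g U `&` P)]) /\
  (exists2 K : set G, compact K & prodset P K = setT).

(* wd_weight is only relevant on wd_set. *)
Record weightedDelone := WeightedDelone {
  wd_set : set G ;
  wd_weight : G -> R ;
  wd_delone : delone wd_set ;
  wd_bounded : exists2 sigma : R, 1 <= sigma &
    forall x, wd_set x -> sigma^-1 <= wd_weight x <= sigma
}.

Lemma lmulM (g h : G) (A : set G) : lmul g (lmul h A) = lmul (g * h)%g A.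
Proof.
apply/seteqP; split=> [_ [_ [x Ax <-] <-]|_ [x Ax <-]].
  by exists x => //; rewrite mulgA.
by exists (h * x)%g; [exists x|rewrite mulgA].
Qed.

Lemma lmulI (g : G) (A B : set G) : lmul g (A `&` B) = lmul g A `&` lmul g B.
Proof. by rewrite !lmulE preimage_setI. Qed.

Let lmul_delone (g : G) (P : set G) : delone P -> delone (lmul g P).
Proof.
move=> [[U [U0 oU pU UP]] [K cK PK]]; split.
  exists U; split=> // h; rewrite -[h](mulVKg g) -lmulM -lmulI.
  by move=> _ _ [x xUP <-] [y yUP <-]; rewrite (UP _ _ _ xUP yUP).
exists K => //; apply/seteqP; split=> // x _.
have : prodset P K (g^-1 * x)%g by rewrite PK.
move=> [p Pp [k Kk pkE]]; exists (g * p)%g; first by exists p.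
by exists k => //; rewrite -mulgA pkE mulVKg.
Qed.

Let translate_bounded (g : G) (Lam : weightedDelone) :
  exists2 sigma : R, 1 <= sigma & forall x, lmul g (wd_set Lam) x ->
    sigma^-1 <= wd_weight Lam (g^-1 * x)%g <= sigma.
Proof.
have [s s1 sb] := wd_bounded Lam; exists s => // _ [x Px <-].
by rewrite mulKg; exact: sb.
Qed.

Definition wd_translate (g : G) (Lam : weightedDelone) : weightedDelone :=
  WeightedDelone (@lmul_delone g _ (wd_delone Lam)) (translate_bounded g Lam).

Variable Lam : weightedDelone.
Let P := wd_set Lam.
Let alpha := wd_weight Lam.

(* sum of alpha x times the Dirac mass at x, for x in P *)
Definition comb (A : set (borel G)) : \bar R :=
  if `[< borel_set A >] then \esum_(x in P `&` A) (alpha x)%:E else 0%E.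

Let alpha_ge0 x : P x -> 0 <= alpha x.
Proof.
have [s s1 sb] := wd_bounded Lam => /sb/andP[+ _]; apply: le_trans.
by rewrite invr_ge0 (le_trans _ s1).
Qed.

Let comb0 : comb set0 = 0%E.
Proof. by rewrite /comb setI0 esum_set0 if_same. Qed.

Let comb_ge0 A : (0 <= comb A)%E.
Proof.
rewrite /comb; case: ifPn => // _; apply: esum_ge0 => x [Px _].
by rewrite lee_fin alpha_ge0.
Qed.

Let comb_sigma_additive : semi_sigma_additive comb.
Proof.
move=> F mF tF mUF.
pose f x := if x \in P then (alpha x)%:E else 0%E.
have f0 x : (0 <= f x)%E.
  by rewrite /f; case: ifPn => // /set_mem Px; rewrite lee_fin alpha_ge0.
have combE A : borel_set A -> comb A = \esum_(x in A) f x.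
  by move=> bA; rewrite /comb asboolT// esum_mkcondl.
rewrite combE// nneseries_sum_bigcup//.
rewrite (_ : (fun n => _) = (fun n => \sum_(0 <= i < n) \esum_(x in F i) f x)%E).
  by apply: is_cvg_nneseries => n _ _; exact: esum_ge0.
by apply/funext => n; apply: eq_bigr => i _; rewrite combE//; exact: mF.
Qed.

HB.instance Definition _ := isMeasure.Build _ (borel G) R comb
  comb0 comb_ge0 comb_sigma_additive.

Let comb_compact (K : set G) : compact K -> (comb K < +oo)%E.
Proof.
move=> cK; rewrite /comb; case: ifPn => // _.
have [[U [[u Uu] oU _ UP]] _] := wd_delone Lam.
suff fPK : finite_set (P `&` K).
  rewrite esum_fset//; last by move=> x /set_mem[Px _]; rewrite lee_fin alpha_ge0.
  by rewrite fsumEFin// ltry.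
have {}cK : cover_compact K by rewrite -compact_cover.
have [g _||D _ KD] := cK G setT (fun g => lmul g U).
- rewrite lmulE; apply: open_comp => // x _; exact: lmulg_continuous.
- by move=> x _; exists (x * u^-1)%g => //; exists u; rewrite ?mulgVK.
pose F g := lmul g U `&` P.
have fF : finite_set (\bigcup_(g in [set` D]) F g).
  apply: bigcup_finite => [|g _]; first exact: finite_fset.
  have [->|/set0P[a Fa]] := eqVneq (F g) set0; first exact: finite_set0.
  by apply: (@sub_finite_set _ _ [set a]) => // x Fx; exact: UP Fx Fa.
by apply: sub_finite_set fF => x [Px /KD[g gD gUx]]; exists g.
Qed.

Let comb_nonborel (A : set G) : ~ borel_set A -> comb A = 0%E.
Proof. by move=> nbA; rewrite /comb asboolF. Qed.

Definition dirac_comb : radonMeasure R G :=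
  @RadonMeasure R G comb comb_compact comb_nonborel.

End delone.

Section hull.
Variables (R : realType) (G : topologicalGroupType).

Lemma dirac_comb_translate (g : G) (Lam : weightedDelone R G) :
  dirac_comb (wd_translate g Lam) = radon_act g (dirac_comb Lam).
Proof.
apply: radonP => A bA; rewrite /= /lpush /comb !asboolT//; last exact: borel_lmulg.
rewrite (@reindex_esum _ _ _ (wd_set Lam `&` (fun x => (g * x)%g) @^-1` A) _
  (fun x => (g * x)%g)).
  by apply: eq_esum => x _ /=; rewrite mulKg.
split=> [x [Px Agx]|x y _ _ /mulgI//|_ [[x Px <-] Agx]].
  by split=> //; exists x.
by exists x.
Qed.

(* The elements of the hull are identified with Radon measures. *)
Definition hull (Lam : weightedDelone R G) : set (radonMeasure R G) :=
  closure [set dirac_comb (wd_translate g Lam) | g in [set: G]].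

End hull.

Section haar.
Variables (R : realType) (G : topologicalGroupType) (mG : radonMeasure R G).

Definition haar : Prop :=
  mG setT <> 0%E /\
  forall (g : G) (A : set G), borel_set A -> mG (lmul g A) = mG A.

(* for mG a left Haar measure *)
Definition unimodular : Prop :=
  forall (g : G) (A : set G), borel_set A -> mG (rmul A g) = mG A.

Definition bounded_borel (f : G -> R) : Prop :=
  measurable_fun [set: borel G] (f : borel G -> R) /\
  exists M : R, forall x, `|f x| <= M.

(* A left-invariant mean on L^oo(G); elements of L^oo(G) are given by bounded
   Borel representatives, and positivity up to null sets makes M depend on
   classes only. *)
Definition left_invariant_mean (M : (G -> R) -> R) : Prop :=
  [/\ M (fun=> 1) = 1,
      forall (a : R) f h, bounded_borel f -> bounded_borel h ->
        M (fun x => a * f x + h x) = a * M f + M h,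
      forall f, bounded_borel f -> {ae mG, forall x : borel G, 0 <= f x} -> 0 <= M f &
      forall (g : G) f, bounded_borel f -> M (fun x => f (g^-1 * x)%g) = M f].

Definition amenable : Prop := exists M, left_invariant_mean M.

(* For compact J and Borel L, Kboundary J L need not be a Borel set (only
   analytic), so that the volume of boundaries is taken with the outer measure,
   which is the completion of mG on analytic sets and mG on Borel sets. *)
Definition bdvol (J L : set G) : \bar R := (mG^* (Kboundary J L))%mu.

Definition vol (A : set G) : R := fine (mG A).

Definition folner (T : nat -> set G) : Prop :=
  (forall m, compact (T m) /\ (0 < mG (T m))%E) /\
  (forall K : set G, K !=set0 -> compact K ->
    vol (T m `+` prodset K (T m)) / vol (T m) @[m --> \oo] --> (0 : R)).

Definition strong_folner_exhaustion (T : nat -> set G) : Prop :=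
  [/\ folner T,
      forall K : set G, compact K ->
        fine (bdvol K (T m)) / vol (T m) @[m --> \oo] --> (0 : R),
      forall m, T m 1%g /\ T m `<=` (T m.+1)° &
      \bigcup_m T m = setT].

Definition relcompact_borel (A : set G) : Prop := precompact A /\ borel_set A.

End haar.

Section metric.
Variables (R : realType) (G : topologicalGroupType) (d : G -> G -> R).

Definition dball (y : G) (delta : R) : set G := [set x | d y x < delta].

Definition continuous_adapted_metric : Prop :=
  [/\ (forall x y, d x y = 0 <-> x = y) /\ (forall x y, d x y = d y x) /\
        (forall x y z, d x z <= d x y + d y z),
      forall g x y, d (g * x)%g (g * y)%g = d x y,
      forall y delta, precompact (dball y delta),
      forall x : G, exists2 U : set G, nbhs x U &
        exists M : R, forall y z, U y -> U z -> d y z <= M &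
      continuous (fun p : G * G => d p.1 p.2)].

Definition measure_dist (S : set G) (mu nu : set (borel G) -> \bar R) : \bar R :=
  ereal_inf [set delta%:E | delta in [set delta : R | 0 < delta /\
    forall y, S y -> (msupp mu `|` msupp nu) y ->
      (`|mu (dball y delta) - nu (dball y delta)| < delta%:E)%E]].

Definition restr (mu : set (borel G) -> \bar R) (S : set G) :
  set (borel G) -> \bar R := fun A => mu (A `&` S).

Definition patch : Type := (set (borel G) -> \bar R) * set G.

Definition patch_of (mu : radonMeasure R G) (S : set G) : patch := (restr mu S, S).

Definition patch_translate (g : G) (p : patch) : patch :=
  (lpush g p.1, lmul g p.2).

Definition pattern_of (p : patch) : set patch :=
  [set patch_translate g p | g in [set: G]].

Definition patterns_of_size (Lam : weightedDelone R G) (S : set G) :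
    set (set patch) :=
  [set pattern_of (patch_of (dirac_comb Lam) (lmul k S)) | k in [set: G]].

(* independent of the chosen representative p of the pattern C *)
Definition occurs (Lam : weightedDelone R G) (delta : R) (C : set patch)
    (T : set G) : Prop :=
  exists2 p, C p & exists g, lmul g p.2 `<=` T /\
    (measure_dist (lmul g p.2) (lpush g p.1)
       (restr (dirac_comb Lam) (lmul g p.2)) < delta%:E)%E.

Definition repetitive_at (Lam : weightedDelone R G) (T : nat -> set G)
    (delta : R) (m n : nat) : Prop :=
  forall C, patterns_of_size Lam (invset (T m)°) C ->
    forall h, occurs Lam delta C (lmul h (invset (T n)°)).

(* The infimum of the n with repetitive_at Lam T delta m n; None stands for
   infinity. *)
Definition repetitivity (Lam : weightedDelone R G) (T : nat -> set G)
    (delta : R) (m : nat) : option nat :=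
  if pselect (exists n, `[< repetitive_at Lam T delta m n >]) is left e
  then Some (ex_minn e) else None.

Definition zeta (mG : radonMeasure R G) (Lam : weightedDelone R G)
    (T : nat -> set G) (delta : R) : R :=
  if `[< exists m, repetitivity Lam T delta m = None >] then 0
  else inf [set vol mG (T m) / vol mG (T (odflt 0 (repetitivity Lam T delta m))%N)
           | m in [set: nat]].

Definition almost_tempered_repetitive (mG : radonMeasure R G)
    (Lam : weightedDelone R G) (T : nat -> set G) : Prop :=
  forall delta, 0 < delta < 1 -> 0 < zeta mG Lam T delta.

End metric.

Section weight_functions.
Variables (R : realType) (G : topologicalGroupType).
Variables (mG : radonMeasure R G) (d : G -> G -> R) (Lam : weightedDelone R G).
(* Only the values w K x for K relatively compact Borel and x in the hull are
   constrained. *)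
Variable w : set G -> radonMeasure R G -> R.

Let RK := @relcompact_borel G.

Definition weight_W1 : Prop := forall x, hull Lam x -> w set0 x = 0.

Definition weight_W2 : Prop :=
  exists J : set G, compact J /\ exists eta : R, 0 < eta /\
    forall x K L, hull Lam x -> RK K -> RK L -> K `<=` L ->
      (`|w L x - w K x|%:E <=
         eta%:E * (mG (L `\` K) + bdvol mG J L + bdvol mG J K))%E.

Definition weight_W3 : Prop :=
  exists B : set G, compact B /\ exists theta : R, 0 <= theta /\
    forall (n : nat) (K : 'I_n -> set G) x, hull Lam x ->
      (forall i, RK (K i)) -> trivIset setT K ->
      ((w (\bigcup_i K i) x)%:E <=
         (\sum_(i < n) (w (K i) x)%:E) +
         theta%:E * (\sum_(i < n) bdvol mG B (K i)))%E.

Definition weight_W4 : Prop :=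
  exists I : set G, compact I /\ exists vartheta : R, 0 <= vartheta /\
    forall x K (h : G), hull Lam x -> RK K ->
      (`|w K x - w (rmul K h^-1%g) (radon_act h x)|%:E <=
         vartheta%:E * bdvol mG I K)%E.

Definition weight_W5 : Prop :=
  forall T, strong_folner_exhaustion mG T -> forall eps : R, 0 < eps ->
    exists delta : R, 0 < delta /\ exists m0 : nat, forall m, (m0 <= m)%N ->
      forall Pi Phi, hull Lam Pi -> hull Lam Phi ->
        (measure_dist d (invset (T m)) Pi Phi <= delta%:E)%E ->
        `|w (T m) Phi - w (T m) Pi| <= eps * vol mG (T m).

Definition admissible : Prop :=
  [/\ weight_W1, weight_W2, weight_W3, weight_W4 & weight_W5].

End weight_functions.

(* Main.v *)
From HB Require Import structures.
Require Import Defs.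
From mathcomp Require Import all_boot all_order all_algebra.
From mathcomp Require Import finmap.
From mathcomp Require Import all_classical all_reals all_analysis.
From mathcomp Require Import measurable_realfun zify ring lra.

Set Implicit Arguments.
Unset Strict Implicit.
Unset Printing Implicit Defensive.

Import Order.TTheory GRing.Theory Num.Theory.
Import numFieldNormedType.Exports.

Local Open Scope classical_set_scope.
Local Open Scope ring_scope.

(** Why the limit exists, and why it does not depend on the sequence.

Fix the configuration Lam and write f A for the weight of A at Lam.  Let I be
the limit superior of f A / |A| as A becomes more and more invariant, that is,
the infimum of the numbers a such that f A <= a |A| holds for all A whose
K-boundary is at most rho |A|, for some compact K and rho > 0.  No sequence
enters this definition.  Since w (T m) (g Lam) is, up to a boundary term, the
weight f of the equally invariant set (T m) g, the inequality
w (T m) (g Lam) <= (I + e) |T m| holds for large m, uniformly in g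
([mean_upper]).

The work is in the opposite inequality ([mean_lower]).  Suppose that
w (T m) (k Lam) <= (I - e) |T m| for some large m.  Continuity of w provides a
tolerance delta, which depends on e only, such that every delta-occurrence of
this patch has weight at most (I - e/2) |T m|; by repetitivity, such an
occurrence lies in every translate of T n, where n is the repetitivity index of
m and |T m| >= zeta |T n| with zeta = zeta delta > 0.  Take A much more
invariant than T n, with f A almost I |A|, and choose greedily occurrences
(T m) c in A, each overlapping the union U of the earlier ones in at most the
proportion kappa of its volume.  When no further choice is possible, every
translate of T n inside A meets U in volume at least kappa zeta |T n|, and
averaging over the translates gives |U| >= (kappa zeta / 2) |A|
([translates_meeting], [maximal_packing_dense]).  So a proportion of A that
depends only on e carries a weight below the mean by a definite amount, if
kappa was chosen small compared with e.  The rest A \ U is still almost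
invariant, hence has weight at most (I + e') |A \ U| plus a small multiple of
|A|, with e' as small as desired ([le_mean]).  Subadditivity then contradicts
f A > (I - e') |A| ([no_dense_gap]).  The rest being handled by the very
definition of I, the almost disjoint tiles only have to cover a fixed proportion of A.

Two points of detail.  The patches compared by repetitivity are restricted
measures, while the continuity of w is about unrestricted ones; this is
reconciled by shrinking T m by a compact ball, which again yields a strong
Folner exhaustion sequence ([strong_folner_erosion],
[repetitive_measure_dist]).  And the passage from the orbit of Lam to its hull
uses that each element of the hull is close to an orbit element in the distance
that compares masses of balls ([hull_measure_dist]), after which the continuity
of w applies once more. *)

(** * Translates, products and boundaries of sets in a group *)

Section group_sets.
Variable G : topologicalGroupType.
Implicit Types (g h : G) (A B K L S : set G).

Lemma rmulg_continuous g : continuous (fun x : G => (x * g)%g).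
Proof.
move=> x; apply: (@continuous2_cvg G G G G (nbhs x) _ id (fun=> g)
    (fun y z => (y * z)%g)); first exact: (@mulg_continuous G (x, g)).
- exact: cvg_id.
- exact: cvg_cst.
Qed.

Lemma rmulE A g : rmul A g = (fun x => (x * g^-1)%g) @^-1` A.
Proof.
apply/seteqP; split=> [_ [x Ax <-]|x /= Ax]; first by rewrite /= mulgK.
by exists (x * g^-1)%g; rewrite ?mulgVK.
Qed.

Lemma rmulM A g h : rmul (rmul A g) h = rmul A (g * h)%g.
Proof. by rewrite !rmulE; apply/seteqP; split=> x /=; rewrite invgM mulgA. Qed.

Lemma rmul1 A : rmul A 1%g = A.
Proof. by rewrite rmulE; apply/seteqP; split=> x /=; rewrite invg1 mulg1. Qed.

Lemma rmulS A B g : A `<=` B -> rmul A g `<=` rmul B g.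
Proof. by move=> AB; rewrite !rmulE; apply: preimage_subset. Qed.

Lemma rmulI A B g : rmul (A `&` B) g = rmul A g `&` rmul B g.
Proof. by rewrite !rmulE. Qed.

Lemma invsetE A : invset A = (fun x : G => x^-1)%g @^-1` A.
Proof.
apply/seteqP; split=> [_ [x Ax <-]|x /= Ax]; first by rewrite /= invgK.
by exists (x^-1)%g; rewrite ?invgK.
Qed.

Lemma lmul_invset g A : lmul g (invset A) = invset (rmul A (g^-1)%g).
Proof.
rewrite lmulE !invsetE rmulE; apply/seteqP; split=> x /=;
  by rewrite ?invgM !invgK.
Qed.

Lemma compact_rmul g K : compact K -> compact (rmul K g).
Proof.
by move=> cK; apply: continuous_compact => //; apply: continuous_subspaceT;
  exact: rmulg_continuous.
Qed.

Lemma compact_invset K : compact K -> compact (invset K).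
Proof.
by move=> cK; apply: continuous_compact => //; apply: continuous_subspaceT;
  exact: invg_continuous.
Qed.

Lemma compact_prodset K L : compact K -> compact L -> compact (prodset K L).
Proof.
move=> cK cL.
have -> : prodset K L = (fun x : G * G => (x.1 * x.2)%g) @` (K `*` L).
  apply/seteqP; split=> [_ [x Kx [y Ly <-]]|_ [[x y] [/= Kx Ly] <-]].
    by exists (x, y).
  by exists x => //; exists y.
apply: continuous_compact; last exact: compact_setX.
by apply: continuous_subspaceT; exact: mulg_continuous.
Qed.

Lemma open_rmul g A : open A -> open (rmul A g).
Proof.
by move=> oA; rewrite rmulE; apply: open_comp => // x _; exact: rmulg_continuous.
Qed.

Lemma open_lmul g A : open A -> open (lmul g A).
Proof.
by move=> oA; rewrite lmulE; apply: open_comp => // x _; exact: lmulg_continuous.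
Qed.

Lemma open_invset A : open A -> open (invset A).
Proof.
by move=> oA; rewrite invsetE; apply: open_comp => // x _; exact: invg_continuous.
Qed.

Lemma closed_lmul g A : closed A -> closed (lmul g A).
Proof.
by move=> cA; rewrite lmulE; apply: closed_comp => // x _; exact: lmulg_continuous.
Qed.

(** The tube lemma for the continuous map (k, x) |-> k * x. *)
Lemma open_translates_into K A : compact K -> open A ->
  open [set x | rmul K x `<=` A].
Proof.
move=> cK oA; rewrite openE => x KxA.
have near_k k : K k -> \forall k' \near k & y \near x, A (k' * y)%g.
  move=> Kk; have : nbhs (k * x)%g A.
    by apply: open_nbhs_nbhs; split=> //; apply: KxA; exists k.
  by move/(@mulg_continuous G (k, x)).
have /compact_near_coveringP/(_ _ (nbhs x) (fun y k => A (k * y)%g) _ near_k) := cK.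
by apply: filterS => y KyA _ [k Kk <-]; exact: KyA.
Qed.

Lemma KboundaryS K L S : K `<=` L -> Kboundary K S `<=` Kboundary L S.
Proof.
move=> KL g [[x [Kx Sx]] [y [Ky Sy]]].
by split; [exists x|exists y]; split=> //; exact: rmulS Kx || exact: rmulS Ky.
Qed.

Lemma Kboundary0 K : Kboundary K set0 = set0.
Proof. by rewrite -subset0 => g [[x []]]. Qed.

Lemma Kboundary_rmul K S g : Kboundary K (rmul S g) = rmul (Kboundary K S) g.
Proof.
have HK y : rmul K (y * g^-1)%g = rmul (rmul K y) (g^-1)%g by rewrite rmulM.
rewrite [RHS]rmulE; apply/seteqP; split=> y /=; rewrite /Kboundary/= HK.
  move=> [[x [Kx Sx]] [z [Kz Sz]]]; split.
    by exists (x * g^-1)%g; split; [exists x|move: Sx; rewrite rmulE].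
  by exists (z * g^-1)%g; split; [exists z|move: Sz; rewrite rmulE].
move=> [[_ [[x Kx <-] Sx]] [_ [[z Kz <-] Sz]]]; split.
  by exists x; split=> //; rewrite rmulE.
by exists z; split=> //; rewrite rmulE.
Qed.

(** The boundary of a relatively compact set is relatively compact, hence of
finite volume. *)
Lemma Kboundary_sub K S : Kboundary K S `<=` prodset (invset K) S.
Proof.
move=> g [[_ [[k Kk <-] Skg]] _].
exists (k^-1)%g; first by exists k.
by exists (k * g)%g; rewrite ?mulKg.
Qed.

Lemma Kboundary_setD K A B :
  Kboundary K (A `\` B) `<=` Kboundary K A `|` Kboundary K B.
Proof.
move=> g [[x [Kx [Ax Bx]]] [y [Ky nABy]]].
have [Ay|nAy] := pselect (A y); last by left; split; [exists x|exists y].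
have By : B y by apply: contrapT => nBy; apply: nABy.
by right; split; [exists y|exists x].
Qed.

Lemma Kboundary_setU K A B :
  Kboundary K (A `|` B) `<=` Kboundary K A `|` Kboundary K B.
Proof.
move=> g [[x [Kx [Ax|Bx]]] [y [Ky /not_orP[nAy nBy]]]].
  by left; split; [exists x|exists y].
by right; split; [exists x|exists y].
Qed.

End group_sets.

Section borel_sets.
Variable X : ptopologicalType.

Lemma borelD (A B : set X) : borel_set A -> borel_set B -> borel_set (A `\` B).
Proof. exact: measurableD. Qed.
Lemma borelU (A B : set X) : borel_set A -> borel_set B -> borel_set (A `|` B).
Proof. exact: measurableU. Qed.
Lemma borelI (A B : set X) : borel_set A -> borel_set B -> borel_set (A `&` B).
Proof. exact: measurableI. Qed.
Lemma borel_closed (A : set X) : closed A -> borel_set A.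
Proof.
move=> cA; rewrite -[A]setCK; apply: (@measurableC _ (borel X)).
by apply: borel_open; exact: closed_openC.
Qed.
Lemma borel_compact (A : set X) : hausdorff_space X -> compact A -> borel_set A.
Proof. by move=> hX cA; apply: borel_closed; exact: compact_closed. Qed.

End borel_sets.

Section relcompact_sets.
Variables (G : topologicalGroupType) (hG : hausdorff_space G).
Implicit Types (A B K : set G) (g : G).

Lemma borel_rmul A g : borel_set A -> borel_set (rmul A g).
Proof.
move=> bA; rewrite rmulE -[X in borel_set X]setTI.
have : measurable_fun [set: borel G] (fun x : borel G => (x * g^-1)%g : borel G).
  apply: (@measurability _ _ (borel G) (borel G) _ _ (@open G)) => // _ [U oU <-].
  rewrite setTI; apply: borel_open.
  by apply: open_comp => // x _; exact: rmulg_continuous.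
by apply.
Qed.

Lemma precompactP A : precompact A <-> exists2 K, compact K & A `<=` K.
Proof.
split=> [[K AK [cK _]]|[K cK AK]]; first by exists K.
by exists K => //; split=> //; exact: compact_closed.
Qed.

Lemma RK_compact K : compact K -> relcompact_borel K.
Proof. by move=> cK; split; [exact: compact_precompact|exact: borel_compact]. Qed.

Lemma RK_sub A B : relcompact_borel B -> A `<=` B -> borel_set A ->
  relcompact_borel A.
Proof. by move=> [pB _] AB bA; split=> //; exact: precompact_subset AB pB. Qed.

Lemma RK_setD A B : relcompact_borel A -> relcompact_borel B ->
  relcompact_borel (A `\` B).
Proof. by move=> rA [_ bB]; apply: (RK_sub rA) => //; apply: borelD => //; case: rA. Qed.

Lemma RK_set0 : relcompact_borel (@set0 G).
Proof. by apply: RK_compact; exact: compact0. Qed.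

Lemma RK_rmul A g : relcompact_borel A -> relcompact_borel (rmul A g).
Proof.
move=> [/precompactP[K cK AK] bA]; split; last exact: borel_rmul.
by apply/precompactP; exists (rmul K g); [exact: compact_rmul|exact: rmulS].
Qed.

End relcompact_sets.

(** * Volumes of sets and of boundaries as real numbers *)
Section volume.
Variables (R : realType) (G : topologicalGroupType) (mG : radonMeasure R G).
Hypothesis hG : hausdorff_space G.
Implicit Types (A B E F J K : set G) (g : G).

Definition finite_borel A : Prop := borel_set A /\ (mG A < +oo)%E.

Definition bd K A : R := fine (bdvol mG K A).

Lemma finite_borel_fin_num A : finite_borel A -> mG A \is a fin_num.
Proof. by move=> [_ Aoo]; rewrite ge0_fin_numE. Qed.

Lemma volE A : finite_borel A -> (vol mG A)%:E = mG A.
Proof. by move=> /finite_borel_fin_num/fineK. Qed.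

Lemma vol_ge0 A : 0 <= vol mG A.
Proof. exact: fine_ge0. Qed.

Lemma RK_finite A : relcompact_borel A -> finite_borel A.
Proof.
move=> [/(precompactP hG)[K cK AK] bA]; split=> //.
apply: le_lt_trans (radon_compact mG cK).
by apply: le_measure => //; rewrite inE//; exact: borel_compact.
Qed.

Lemma finite_borel_sub A B : finite_borel B -> A `<=` B -> borel_set A ->
  finite_borel A.
Proof.
move=> [bB Boo] AB bA; split=> //; apply: le_lt_trans Boo.
by apply: le_measure => //; rewrite inE.
Qed.

Lemma finite_borelU A B : finite_borel A -> finite_borel B ->
  finite_borel (A `|` B).
Proof.
move=> [bA Aoo] [bB Boo]; split; first exact: borelU.
by apply: le_lt_trans (measureU2 _ _ _) _ => //; exact: lte_add_pinfty.
Qed.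

Lemma le_vol A B : finite_borel B -> A `<=` B -> borel_set A ->
  vol mG A <= vol mG B.
Proof.
move=> fB AB bA; have fA := finite_borel_sub fB AB bA.
rewrite -lee_fin !volE//; apply: le_measure => //; rewrite inE//.
exact: fB.1.
Qed.

Lemma vol_setU_le A B : finite_borel A -> finite_borel B ->
  vol mG (A `|` B) <= vol mG A + vol mG B.
Proof.
move=> fA fB; rewrite -lee_fin EFinD !volE//; last exact: finite_borelU.
by apply: measureU2; [exact: fA.1|exact: fB.1].
Qed.

Lemma vol_setU A B : finite_borel A -> finite_borel B -> A `&` B = set0 ->
  vol mG (A `|` B) = vol mG A + vol mG B.
Proof.
move=> fA fB AB; apply: EFin_inj; rewrite EFinD !volE//; last exact: finite_borelU.
by apply: measureU => //; [exact: fA.1|exact: fB.1].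
Qed.

Lemma vol_split A B : finite_borel A -> borel_set B ->
  vol mG A = vol mG (A `&` B) + vol mG (A `\` B).
Proof.
move=> fA bB; have bA := fA.1.
rewrite -vol_setU ?setIDK//; first by rewrite setUIDK.
- by apply: (finite_borel_sub fA); [exact: subIsetl|exact: borelI].
- by apply: (finite_borel_sub fA); [exact: subDsetl|exact: borelD].
- by rewrite setDE setIACA setICr setI0.
Qed.

Lemma vol_setD_sub A B : finite_borel A -> borel_set B -> B `<=` A ->
  vol mG (A `\` B) = vol mG A - vol mG B.
Proof. by move=> fA bB BA; rewrite (vol_split fA bB) setIidr// addrC addKr. Qed.

Lemma bdvol_ge0 K A : (0 <= bdvol mG K A)%E.
Proof. exact: outer_measure_ge0. Qed.

Lemma bd_ge0 K A : 0 <= bd K A.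
Proof. by apply: fine_ge0; exact: bdvol_ge0. Qed.

Lemma bdvol_le K A F : borel_set F -> Kboundary K A `<=` F ->
  (bdvol mG K A <= mG F)%E.
Proof.
by move=> bF AF; rewrite -[leRHS]measurable_mu_extE//; exact: le_outer_measure.
Qed.

Lemma bdvolE K A : compact K -> relcompact_borel A -> (bd K A)%:E = bdvol mG K A.
Proof.
move=> cK [/(precompactP hG)[L cL AL] _]; apply: fineK.
rewrite ge0_fin_numE ?bdvol_ge0//.
have cKL : compact (prodset (invset K) L).
  by apply: compact_prodset => //; exact: compact_invset.
apply: le_lt_trans (radon_compact mG cKL); apply: bdvol_le.
  exact: borel_compact.
apply: subset_trans (@Kboundary_sub _ _ _) _.
by move=> _ [x Kx [y /AL Ly <-]]; exists x => //; exists y.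
Qed.

Lemma bd_le K A F : finite_borel F -> Kboundary K A `<=` F -> bd K A <= vol mG F.
Proof.
move=> fF AF; rewrite /bd -lee_fin volE// fineK; first exact: bdvol_le fF.1 AF.
rewrite ge0_fin_numE ?bdvol_ge0//.
by apply: le_lt_trans (bdvol_le fF.1 AF) _; exact: fF.2.
Qed.

(** Boundaries need not be Borel; up to an arbitrarily small loss they may be
replaced by Borel sets, to which additivity applies. *)
Lemma bd_lt K A (r : R) : compact K -> relcompact_borel A -> bd K A < r ->
  exists F, [/\ finite_borel F, Kboundary K A `<=` F & vol mG F < r].
Proof.
move=> cK rA; rewrite -lte_fin bdvolE// => /ereal_inf_lt[_ [F [mF AF] <-] Fr].
have bUF : borel_set (\bigcup_n F n).
  by apply: (@bigcup_measurable _ (borel G)) => n _; exact: mF.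
have UFr : (mG (\bigcup_n F n) < r%:E)%E.
  by apply: le_lt_trans Fr; apply: measure_sigma_subadditive.
have fUF : finite_borel (\bigcup_n F n).
  by split=> //; exact: lt_trans UFr (ltry _).
by exists (\bigcup_n F n); split=> //; rewrite -lte_fin volE.
Qed.

Lemma bdS K L A : K `<=` L -> compact L -> relcompact_borel A ->
  bd K A <= bd L A.
Proof.
move=> KL cL rA; apply/ler_addgt0Pr => e e0.
have [|F [fF AF /ltW Fr]] := bd_lt (r := bd L A + e) cL rA; first by rewrite ltrDl.
by apply: le_trans Fr; apply: bd_le => //; apply: subset_trans AF; exact: KboundaryS.
Qed.

Lemma bd_set0 K : bd K set0 = 0.
Proof. by rewrite /bd /bdvol Kboundary0 outer_measure0. Qed.

Lemma bd_setD K A B : compact K -> relcompact_borel A -> relcompact_borel B ->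
  bd K (A `\` B) <= bd K A + bd K B.
Proof.
move=> cK rA rB; apply/ler_addgt0Pr => e e0.
have e2 : 0 < e / 2 by rewrite divr_gt0.
have [|F [fF AF Fr]] := bd_lt (r := bd K A + e / 2) cK rA; first by rewrite ltrDl.
have [|E [fE BE Er]] := bd_lt (r := bd K B + e / 2) cK rB; first by rewrite ltrDl.
apply: (@le_trans _ _ (vol mG (F `|` E))).
  apply: bd_le; first exact: finite_borelU.
  by apply: subset_trans (@Kboundary_setD _ _ _ _) _; exact: setUSS.
by have := vol_setU_le fF fE; lra.
Qed.

Section haar.
Hypotheses (haarG : haar mG) (uniG : unimodular mG).

Lemma vol_rmul A g : borel_set A -> vol mG (rmul A g) = vol mG A.
Proof. by move=> bA; rewrite /vol uniG. Qed.

Lemma finite_borel_rmul A g : finite_borel A -> finite_borel (rmul A g).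
Proof. by move=> [bA Aoo]; split; [exact: borel_rmul|rewrite uniG]. Qed.

Lemma bd_rmul K A g : compact K -> relcompact_borel A ->
  bd K (rmul A g) = bd K A.
Proof.
suff le B h : compact K -> relcompact_borel B -> bd K (rmul B h) <= bd K B.
  move=> cK rA; apply/eqP; rewrite eq_le le//=.
  by have := le _ (g^-1)%g cK (RK_rmul hG g rA); rewrite rmulM mulgV rmul1.
move=> cK rB; apply/ler_addgt0Pr => e e0.
have [|F [fF BF Fr]] := bd_lt (r := bd K B + e) cK rB; first by rewrite ltrDl.
apply/ltW/(le_lt_trans _ Fr); rewrite -(@vol_rmul F h); last exact: fF.1.
apply: bd_le; first exact: finite_borel_rmul.
by rewrite Kboundary_rmul; exact: rmulS.
Qed.

End haar.
End volume.

(** * Averaging over translates *)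
Section packing.
Variables (R : realType) (G : topologicalGroupType) (mG : radonMeasure R G).
Hypotheses (scG : @second_countable G) (haarG : haar mG) (uniG : unimodular mG).
Hypothesis sfG : sigma_finite setT mG.
Implicit Types (A B E F J K : set G) (g : G).

(** Second countability makes an open set of the square a countable union of
open rectangles, hence measurable for the product of the Borel sigma-algebras. *)
Lemma measurable_mulg :
  measurable_fun [set: (borel G * borel G)%type]
    (fun p : borel G * borel G => (p.1 * p.2)%g : borel G).
Proof.
apply: (@measurability _ _ _ (borel G) _ _ (@open G)) => // _ [W oW <-].
rewrite setTI; case: scG => B cB [Bo Bb].
pose I := [set UV : set G * set G | [/\ B UV.1, B UV.2 &
  UV.1 `*` UV.2 `<=` (fun p : G * G => (p.1 * p.2)%g) @^-1` W]].
have -> : (fun p : borel G * borel G => (p.1 * p.2)%g : borel G) @^-1` W =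
    \bigcup_(UV in I) (UV.1 `*` UV.2 : set (borel G * borel G)).
  apply/seteqP; split=> [[x y] /= Wxy|p [UV [_ _ UVW] Up]]; last exact: (UVW p Up).
  have : nbhs (x * y)%g W by apply: open_nbhs_nbhs.
  move=> /(@mulg_continuous G (x, y))[[U V] [/= xU yV] UVW].
  have [U' [/= BU' U'x] U'U] := Bb x U xU.
  have [V' [/= BV' V'y] V'V] := Bb y V yV.
  exists (U', V') => //; split=> // -[a b] [/= U'a V'b]; apply: (UVW (a, b)).
  by split; [exact: U'U|exact: V'V].
have cI : countable I.
  by apply: sub_countable (countableX cB cB); apply: subset_card_le => UV [].
rewrite bigcup_set_type; apply: countable_bigcupT_measurable => [|[UV /set_mem[/= BU BV _]]].
  by rewrite (eq_countable (card_setT _)).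
by apply: measurableX; apply: borel_open; exact: Bo.
Qed.

Let sfin : {sigma_finite_measure set (borel G) -> \bar R} :=
  HB.pack_for (SigmaFiniteMeasure.type (borel G) R)
    (Measure.sort (radon_measure mG))
    (isSFinite.Build _ (borel G) R (radon_measure mG)
      (sfinite_measure_sigma_finite sfG))
    (isSigmaFinite.Build _ (borel G) R (radon_measure mG) sfG).

(** Tonelli on the set of pairs t in T, h with t * h in U: for fixed t the
section is a left translate of U, for fixed h it is a right translate of
T * h meet U; left and right invariance give the volumes of the sections. *)
Lemma integral_translateI T U : finite_borel mG T -> finite_borel mG U ->
  measurable_fun [set: borel G] (fun h => mG (rmul T h `&` U)) /\
  (\int[mG]_h mG (rmul T h `&` U) = mG T * mG U)%E.
Proof.
move=> fT fU.
pose A : set (borel G * borel G) := (T `*` setT) `&`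
  ((fun p : borel G * borel G => (p.1 * p.2)%g : borel G) @^-1` U).
have mA : measurable A.
  apply: measurableI; first by apply: measurableX => //; exact: fT.1.
  by rewrite -[X in measurable X]setTI; apply: measurable_mulg => //; exact: fU.1.
have yE h : sfin (ysection A h) = mG (rmul T h `&` U).
  rewrite -[RHS](uniG (h^-1)%g); last first.
    by apply: borelI; [exact: borel_rmul fT.1|exact: fU.1].
  congr (mG _); rewrite rmulI rmulM mulgV rmul1.
  apply/seteqP; split=> x; rewrite /ysection rmulE /= inE /A /= invgK.
    by move=> [[]].
  by move=> [].
have xE t : sfin (xsection A t) = ((\1_T t)%:E * mG U)%E.
  rewrite indicE; have [/set_mem Tt|/negP nTt] := boolP (t \in T); last first.
    rewrite mul0e (_ : xsection A t = set0) ?measure0// -subset0 => h.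
    by rewrite /xsection/= inE /A/= => -[[/mem_set]].
  rewrite mul1e -[RHS](haarG.2 (t^-1)%g); last exact: fU.1.
  congr (mG _); apply/seteqP; split=> x; rewrite /xsection lmulE /= inE /A /= invgK //.
  by move=> [].
have mT : measurable (T : set (borel G)) := fT.1.
have yfunE : sfin \o ysection A = fun h => mG (rmul T h `&` U).
  by apply/funext => h /=; exact: yE.
split; first by rewrite -yfunE; exact: measurable_fun_ysection.
have := @indic_fubini_tonelli _ _ _ _ R sfin sfin A mA.
rewrite indic_fubini_tonelli_FE// indic_fubini_tonelli_GE// yfunE => <-.
rewrite (_ : sfin \o xsection A = fun t => ((\1_T t)%:E * mG U)%E); last first.
  by apply/funext => t /=; exact: xE.
rewrite ge0_integralZr//; first by rewrite integral_indic// setIT.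
by apply/measurable_EFinP; exact: measurable_indic.
Qed.

(** Markov's inequality for the previous integral: the translates of T that
meet U in volume at least r fill a set of volume at most |T||U|/r. *)
Lemma translates_meeting T U (r : R) : 0 < r ->
  finite_borel mG T -> finite_borel mG U ->
  exists H, [/\ finite_borel mG H, r * vol mG H <= vol mG T * vol mG U &
    forall h, r <= vol mG (rmul T h `&` U) -> H h].
Proof.
move=> r0 fT fU; have [mf intf] := integral_translateI fT fU.
pose H := [set: borel G] `&` [set h | (r%:E <= `|mG (rmul T h `&` U)|)%E].
have bH : borel_set H.
  apply: emeasurable_fun_c_infty => //; exact: measurableT_comp.
have rH : (r%:E * mG H <= (vol mG T * vol mG U)%:E)%E.
  rewrite EFinM !volE// -intf.
  apply: le_trans (le_integral_abse mG measurableT mf r0) _.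
  by under eq_integral do rewrite gee0_abs//.
have fH : finite_borel mG H.
  split=> //; rewrite ltey; apply/eqP => Hoo.
  by move: rH; rewrite Hoo gt0_muley ?lte_fin// leye_eq.
exists H; split=> //; first by rewrite -lee_fin EFinM volE.
move=> h rh; split=> //=; rewrite gee0_abs// -volE ?lee_fin//.
apply: (finite_borel_sub fU); first exact: subIsetr.
by apply: borelI; [exact: borel_rmul fT.1|exact: fU.1].
Qed.
End packing.

(** * The mean of a weight *)
Section asymptotic_mean.
Variables (R : realType) (G : topologicalGroupType) (mG : radonMeasure R G).
Hypotheses (hG : hausdorff_space G) (scG : @second_countable G).
Hypotheses (haarG : haar mG) (uniG : unimodular mG).
Hypothesis sfG : sigma_finite setT mG.
Implicit Types (A B E F J K S T U : set G) (g c : G).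

Local Notation v := (vol mG).
Local Notation bd := (bd mG).

Definition almost_invariant K (rho : R) A : Prop :=
  [/\ relcompact_borel A, 0 < v A & bd K A <= rho * v A].

Variables (Q : set G) (C : R) (f : set G -> R).
Hypotheses (cQ : compact Q) (Q1 : Q 1%g) (C1 : 1 <= C) (f0 : f set0 = 0).
Hypothesis f_lip : forall K L, relcompact_borel K -> relcompact_borel L ->
  K `<=` L -> `|f L - f K| <= C * (v (L `\` K) + bd Q L + bd Q K).
Hypothesis f_subadd : forall n (K : 'I_n -> set G),
  (forall i, relcompact_borel (K i)) -> trivIset setT K ->
  f (\bigcup_i K i) <= \sum_(i < n) f (K i) + C * \sum_(i < n) bd Q (K i).
Hypothesis invariant_ex : forall K (rho : R), compact K -> 0 < rho ->
  exists A, almost_invariant K rho A.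

Definition eventual_bounds : set R := [set a | exists K (rho : R),
  [/\ compact K, 0 < rho & forall A, almost_invariant K rho A -> f A <= a * v A]].

(** The limit superior of f A / |A| as A becomes more and more invariant. *)
Definition asymptotic_mean : R := inf eventual_bounds.
Local Notation Im := asymptotic_mean.

Lemma f_bound A : relcompact_borel A -> `|f A| <= C * (v A + bd Q A).
Proof.
move=> rA; have := f_lip (RK_set0 hG) rA (@sub0set _ A).
by rewrite f0 subr0 setD0 bd_set0 addr0.
Qed.

Lemma f_bound_invariant A : almost_invariant Q 1 A -> `|f A| <= 2 * C * v A.
Proof.
move=> [rA A0 bA]; apply: le_trans (f_bound rA) _.
by rewrite mul1r in bA; have := C1; nra.
Qed.

Lemma eventual_bounds_ge a : eventual_bounds a -> - (2 * C) <= a.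
Proof.
move=> [K [rho [cK rho0 fa]]].
have cKQ := compactU cK cQ.
have [|A [rA A0 bA]] := @invariant_ex _ (Num.min rho 1) cKQ.
  by rewrite lt_min rho0/=.
have iA L s : L `<=` K `|` Q -> Num.min rho 1 <= s -> almost_invariant L s A.
  move=> LKQ rs; split=> //; apply: le_trans (bdS mG hG LKQ cKQ rA) _.
  by apply: le_trans bA _; rewrite ler_wpM2r// ltW.
have /fa fA : almost_invariant K rho A by apply: iA => //; rewrite ge_min lexx.
have /f_bound_invariant/ler_normlP[fA' _] : almost_invariant Q 1 A.
  by apply: iA => //; rewrite ge_min lexx orbT.
by rewrite -(ler_pM2r A0); lra.
Qed.

Lemma eventual_bounds_2C : eventual_bounds (2 * C).
Proof.
exists Q, 1; split=> // A iA.
by apply: le_trans (f_bound_invariant iA); exact: ler_norm.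
Qed.

Lemma eventual_bounds_inf : has_inf eventual_bounds.
Proof.
split; first by exists (2 * C); exact: eventual_bounds_2C.
by exists (- (2 * C)) => a; exact: eventual_bounds_ge.
Qed.

Lemma asymptotic_mean_bound : `|Im| <= 2 * C.
Proof.
rewrite ler_norml; apply/andP; split.
  by apply: lb_le_inf; [exact: eventual_bounds_inf.1|move=> a; exact: eventual_bounds_ge].
by apply: ge_inf; [exact: eventual_bounds_inf.2|exact: eventual_bounds_2C].
Qed.

(** The mean cannot be lowered, so it is nearly attained on arbitrarily
invariant sets. *)
Lemma near_mean_ex (e : R) K (rho : R) : 0 < e -> compact K -> 0 < rho ->
  exists A, almost_invariant K rho A /\ (Im - e) * v A < f A.
Proof.
move=> e0 cK rho0; apply: contrapT => /forallNP nA.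
have : eventual_bounds (Im - e).
  exists K, rho; split=> // A iA; rewrite leNgt; apply/negP => fA.
  by apply: (nA A).
by move/(ge_inf eventual_bounds_inf.2); rewrite -/Im; lra.
Qed.

(** The error is measured by a volume a that dominates that of A: this covers
very small sets, which may fail to be invariant but have a negligible weight. *)
Lemma le_mean (e : R) : 0 < e -> exists K (rho : R),
  [/\ compact K, Q `<=` K, 0 < rho & forall A (a : R), relcompact_borel A ->
    v A <= a -> bd K A <= rho * a -> f A <= Im * v A + e * a].
Proof.
move=> e0.
have [a0 [K0 [rho0 [cK0 rho00 fK0]]] a0I] : exists2 a, eventual_bounds a & a < Im + e.
  by apply: inf_adherent => //; exact: eventual_bounds_inf.
pose tau := e / (8 * C).
have C0 : 0 < C by have := C1; lra.
have tau0 : 0 < tau by rewrite divr_gt0// mulr_gt0.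
have tauC : C * tau = e / 8 by rewrite /tau; field; lra.
have cKQ := compactU cK0 cQ.
exists (K0 `|` Q), (Num.min (rho0 * tau) tau); split => //.
  by rewrite lt_min tau0 mulr_gt0.
move=> A a rA Aa bA; have A0 := vol_ge0 mG A.
have a_ge0 : 0 <= a by lra.
have bA0 : bd (K0 `|` Q) A <= rho0 * tau * a.
  by apply: le_trans bA _; rewrite ler_wpM2r// ge_min lexx.
have bA1 : bd (K0 `|` Q) A <= tau * a.
  by apply: le_trans bA _; rewrite ler_wpM2r// ge_min lexx orbT.
have [Ata|Ata] := leP (v A) (tau * a).
  have /ler_normlP[_ fA] := f_bound rA.
  have bQ : bd Q A <= tau * a by apply: le_trans (bdS mG hG _ cKQ rA) bA1.
  have /ler_normlP[Ib _] := asymptotic_mean_bound.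
  have h1 : f A <= C * (tau * a + tau * a).
    by apply: le_trans fA _; apply: ler_wpM2l; [exact: ltW|exact: lerD].
  have h2 : - (2 * C * (tau * a)) <= Im * v A.
    have h : - (2 * C) * v A <= Im * v A by rewrite ler_wpM2r// lerNl.
    have : 2 * C * v A <= 2 * C * (tau * a) by rewrite ler_wpM2l// mulr_ge0// ltW.
    lra.
  have h3 : C * (tau * a + tau * a) + 2 * C * (tau * a) = e * a / 2.
    transitivity (C * tau * (4 * a)); first by ring.
    by rewrite tauC; field.
  by nra.
have A_gt0 : 0 < v A by apply: le_lt_trans Ata; rewrite mulr_ge0// ltW.
have : f A <= a0 * v A.
  apply: fK0; split=> //; apply: le_trans (bdS mG hG _ cKQ rA) (le_trans bA0 _) => //.
  by rewrite -mulrA ler_pM2l// ltW.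
by nra.
Qed.
End asymptotic_mean.

(** * Greedy packings by almost disjoint tiles *)
Section greedy_packing.
Variables (R : realType) (G : topologicalGroupType) (mG : radonMeasure R G).
Hypothesis hG : hausdorff_space G.
Hypothesis uniG : unimodular mG.
Implicit Types (A B E F J K S T U : set G) (g c : G) (cs : seq G).
Local Notation v := (vol mG).
Local Notation bd := (bd mG).

Variables (S A : set G) (P : set G) (kappa : R).
Hypotheses (rS : relcompact_borel S) (rA : relcompact_borel A).

(** The head of a list of translation parameters is the tile chosen last. *)
Fixpoint tiles cs : set G :=
  if cs is c :: cs' then rmul S c `|` tiles cs' else set0.

(** The tiles made disjoint. *)
Fixpoint pieces cs : seq (set G) :=
  if cs is c :: cs' then (rmul S c `\` tiles cs') :: pieces cs' else [::].

Definition admissible_tile cs c : Prop :=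
  [/\ P c, rmul S c `<=` A & v (rmul S c `&` tiles cs) <= kappa * v S].

Fixpoint packing cs : Prop :=
  if cs is c :: cs' then admissible_tile cs' c /\ packing cs' else True.

Lemma RK_setU B B' : relcompact_borel B -> relcompact_borel B' ->
  relcompact_borel (B `|` B').
Proof.
move=> [/(precompactP hG)[K cK BK] bB] [/(precompactP hG)[K' cK' BK'] bB'].
split; last exact: borelU.
by apply/(precompactP hG); exists (K `|` K'); [exact: compactU|exact: setUSS].
Qed.

Lemma RK_tiles cs : relcompact_borel (tiles cs).
Proof.
by elim: cs => [|c cs IH]/=; [exact: RK_set0|apply: RK_setU => //; exact: RK_rmul].
Qed.

Lemma RK_pieces cs i : relcompact_borel (nth set0 (pieces cs) i).
Proof.
elim: cs i => [|c cs IH] [|i]/=; try exact: RK_set0; last exact: IH.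
by apply: RK_setD; [exact: RK_rmul|exact: RK_tiles].
Qed.

Lemma size_pieces cs : size (pieces cs) = size cs.
Proof. by elim: cs => //= c cs ->. Qed.

Lemma tiles_sub cs : packing cs -> tiles cs `<=` A.
Proof.
by elim: cs => [_|c cs IH [[_ cA _] /IH UA]]; [exact: sub0set|rewrite /= subUset].
Qed.

Lemma piece_sub_tiles cs i : nth set0 (pieces cs) i `<=` tiles cs.
Proof.
elim: cs i => [|c cs IH] [|i]//=; first by move=> x []; left.
by move=> x /IH; right.
Qed.

Lemma pieces_disjoint cs i j : (i < j)%N ->
  nth set0 (pieces cs) i `&` nth set0 (pieces cs) j = set0.
Proof.
elim: cs i j => [|c cs IH] [|i] [|j]//= ij; rewrite ?set0I// ?IH//.
by rewrite -subset0 => x [[_ nU] /piece_sub_tiles].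
Qed.

Lemma tilesE cs : tiles cs = \bigcup_(i < size cs) nth set0 (pieces cs) i.
Proof.
elim: cs => [|c cs IH]/=; first by rewrite bigcup_mkord big_ord0.
rewrite bigcup_mkord big_ord_recl/= -bigcup_mkord -IH.
by rewrite setUDl setDv setD0.
Qed.

Lemma finite_rmul_S c : finite_borel mG (rmul S c).
Proof. by apply: RK_finite => //; exact: RK_rmul. Qed.

Lemma finite_tiles cs : finite_borel mG (tiles cs).
Proof. by apply: RK_finite => //; exact: RK_tiles. Qed.

Lemma vol_tiles_cons cs c B : borel_set B -> v (tiles (c :: cs) `&` B) =
  v ((rmul S c `\` tiles cs) `&` B) + v (tiles cs `&` B).
Proof.
move=> bB; have bS := (finite_rmul_S c).1; have bU := (RK_tiles cs).2.
rewrite -vol_setU.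
- by rewrite -setIUl setUDl setDv setD0.
- apply: (finite_borel_sub (finite_rmul_S c)) => [x [[]]//|].
  by apply: borelI => //; exact: borelD.
- by apply: (finite_borel_sub (finite_tiles cs)) => [x []//|]; exact: borelI.
- by rewrite -subset0 => x [[[_ nU] _] [Ux _]].
Qed.

Lemma vol_piece cs c : v (rmul S c `\` tiles cs) = v S - v (rmul S c `&` tiles cs).
Proof.
have := vol_split (finite_rmul_S c) (RK_tiles cs).2.
by rewrite (vol_rmul uniG) ?rS.2//; [lra|exact: rS.2].
Qed.

Lemma vol_tiles cs : packing cs ->
  (1 - kappa) * (size cs)%:R * v S <= v (tiles cs) <= (size cs)%:R * v S.
Proof.
elim: cs => [_|c cs IH [[_ _ cU] /IH/andP[IH1 IH2]]].
  by rewrite /= mulr0 mul0r /vol measure0 lexx.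
have := vol_tiles_cons cs c (@measurableT _ (borel G)).
rewrite !setIT vol_piece => ->.
rewrite [size _]/= -natr1.
have := vol_ge0 mG (rmul S c `&` tiles cs).
by move=> h; apply/andP; split; nra.
Qed.

(** A packing that cannot be extended: each tile takes a fixed volume away
from A, so that the number of tiles is bounded. *)
Lemma maximal_packing : kappa < 1 -> 0 < v S ->
  exists cs, packing cs /\ forall c, ~ admissible_tile cs c.
Proof.
move=> k1 S0; apply: contrapT => /forallNP nmax.
have long n : exists cs, packing cs /\ size cs = n.
  elim: n => [|n [cs [pcs <-]]]; first by exists [::].
  have /not_andP[//|/existsNP[c /contrapT ac]] := nmax cs.
  by exists (c :: cs).
have d0 : 0 < (1 - kappa) * v S by rewrite mulr_gt0// subr_gt0.
have [n nA] : exists n : nat, v A / ((1 - kappa) * v S) < n%:R.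
  by exists (Num.trunc (v A / ((1 - kappa) * v S))).+1; rewrite truncnS_gt.
have [cs [pcs sn]] := long n.
have /andP[+ _] := vol_tiles pcs; rewrite leNgt sn => /negP; apply.
apply: (@le_lt_trans _ _ (v A)).
  by apply: le_vol; [exact: RK_finite|exact: tiles_sub|exact: (RK_tiles cs).2].
by move: nA; rewrite ltr_pdivrMr// mulrA (mulrC n%:R).
Qed.

Variables (K F : set G).
Hypotheses (K1 : K 1%g) (fF : finite_borel mG F) (SF : Kboundary K S `<=` F).

Fixpoint tile_boundaries cs : set G :=
  if cs is c :: cs' then rmul F c `|` tile_boundaries cs' else set0.

Lemma finite_tile_boundaries cs : finite_borel mG (tile_boundaries cs).
Proof.
elim: cs => [|c cs IH]/=; first by apply: RK_finite => //; exact: RK_set0.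
by apply: finite_borelU => //; exact: finite_borel_rmul.
Qed.

Lemma vol_tile_boundaries cs : v (tile_boundaries cs) <= (size cs)%:R * v F.
Proof.
elim: cs => [|c cs IH]; first by rewrite /= mul0r /vol measure0.
rewrite [size _]/= -natr1 mulrDl mul1r addrC.
apply: le_trans (vol_setU_le (finite_borel_rmul uniG c fF) (finite_tile_boundaries cs)) _.
by rewrite (vol_rmul uniG); [exact: lerD|exact: fF.1].
Qed.

Lemma Kboundary_tiles cs : Kboundary K (tiles cs) `<=` tile_boundaries cs.
Proof.
elim: cs => [|c cs IH]/=; first by rewrite Kboundary0.
apply: subset_trans (@Kboundary_setU _ _ _ _) _; apply: setUSS => //.
by rewrite Kboundary_rmul; exact: rmulS.
Qed.

(** The boundary of a piece consists of boundary points of its tile and of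
points of the tile that are boundary points of earlier tiles.  The latter lie
in the overlap of the tile with the earlier ones, or in the piece itself; the
pieces being disjoint, the second kind adds up to at most the volume of all
tile boundaries. *)
Lemma sum_bd_pieces cs B : packing cs -> borel_set B -> tile_boundaries cs `<=` B ->
  \sum_(p <- pieces cs) bd K p <=
    (size cs)%:R * (v F + kappa * v S) + v (tiles cs `&` B).
Proof.
move=> + bB; elim: cs => [_ _|c cs IH [[_ _ cU] pcs]].
  by rewrite big_nil mul0r add0r vol_ge0.
rewrite subUset => -[cB csB]; rewrite [pieces _]/= big_cons.
rewrite [size _]/= -natr1 vol_tiles_cons//.
have := IH pcs csB.
set Pc := rmul S c `\` tiles cs.
have bS := (finite_rmul_S c).1; have bU := (RK_tiles cs).2.
have bPc : borel_set Pc by exact: borelD.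
have fI : finite_borel mG (Pc `&` B).
  apply: (finite_borel_sub (finite_rmul_S c)) => [x [[]]//|].
  exact: borelI.
have fJ : finite_borel mG (rmul S c `&` tiles cs).
  by apply: (finite_borel_sub (finite_rmul_S c)) => [x []//|]; exact: borelI.
have fFc := finite_borel_rmul uniG c fF.
have -> : (size cs)%:R + 1 = 1 + (size cs)%:R :> R by rewrite addrC.
have : bd K Pc <= v F + kappa * v S + v (Pc `&` B).
  apply: (@le_trans _ _ (v (rmul F c `|` ((rmul S c `&` tiles cs) `|` (Pc `&` B))))).
    apply: bd_le; first by do 2 apply: finite_borelU => //.
    move=> g gP; have [|gU] := Kboundary_setD gP.
      by rewrite Kboundary_rmul => gS; left; exact: rmulS gS.
    have [gS|ngS] := pselect (Kboundary K (rmul S c) g).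
      by left; move: gS; rewrite Kboundary_rmul; exact: rmulS.
    right; have Bg : B g by apply: csB; exact: Kboundary_tiles.
    have Sg : rmul S c g.
      apply: contrapT => nSg; apply: ngS; split; last first.
        by exists g; split=> //; exists 1%g; rewrite ?mul1g.
      by case: gP => -[x [Kx [Sx _]]] _; exists x.
    by have [Ug|nUg] := pselect (tiles cs g); [left|right].
  apply: le_trans (vol_setU_le fFc (finite_borelU fJ fI)) _.
  rewrite -addrA (vol_rmul uniG); last exact: fF.1.
  by rewrite lerD2l; apply: le_trans (vol_setU_le fJ fI) _; rewrite lerD2r.
lra.
Qed.

End greedy_packing.

(** * Gaps below the mean are not dense *)
(** Here a is the volume of the large set, u the volume covered by tiles, N the
volume of the tiles counted with multiplicity; fs and b are the sums over the
pieces of the weights and of the boundaries, fr and r the weight and the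
boundary of the uncovered rest. *)
Lemma gap_arithmetic (R : realFieldType)
    (C kappa a N e beta rho q I u z fs fA fr b r : R) :
  0 < C -> 0 <= kappa -> 0 <= a -> 0 <= N ->
  C * kappa <= e / 40 -> C * beta <= e / 40 -> C * rho <= q / 4 ->
  `|I| <= 2 * C -> (1 - kappa) * N <= u -> u <= N ->
  kappa * z / 2 * a <= u -> q = e * kappa * z / 4 ->
  fs <= N * (I - e + C * (kappa + beta)) + C * b ->
  fA <= fr + fs + C * (r + b) ->
  fr <= I * (a - u) + q / 2 * a ->
  b <= (2 * beta + kappa) * N -> r <= rho * a + beta * N -> 0 < q -> 0 < e ->
  fA <= (I - q / 2) * a.
Proof.
move=> C0 k0 a0 N0 Ck Cb Cr IC uN Nu dense qE sf fle frle bN rN q0 e0.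
have Cb1 : C * b <= C * ((2 * beta + kappa) * N) by rewrite ler_pM2l.
have Cr1 : C * r <= C * (rho * a + beta * N) by rewrite ler_pM2l.
have CkN : C * kappa * N <= e / 40 * N by rewrite ler_wpM2r.
have CbN : C * beta * N <= e / 40 * N by rewrite ler_wpM2r.
have CrA : C * rho * a <= q / 4 * a by rewrite ler_wpM2r.
have INu : I * (N - u) <= 2 * (C * kappa * N).
  apply: (@le_trans _ _ (2 * C * (N - u))).
    by rewrite ler_wpM2r ?subr_ge0//; move/ler_normlP: IC => [].
  rewrite -!mulrA ler_pM2l// ler_pM2l//; lra.
have eu : 2 * q * a <= e * N.
  apply: (@le_trans _ _ (e * (kappa * z / 2 * a))).
    by rewrite le_eqVlt; apply/orP; left; apply/eqP; rewrite qE; field.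
  by rewrite ler_pM2l//; lra.
have qA : 0 <= q * a by rewrite mulr_ge0// ltW.
have eN : 0 <= e * N by rewrite mulr_ge0// ltW.
lra.
Qed.

Section mean_gain.
Variables (R : realType) (G : topologicalGroupType) (mG : radonMeasure R G).
Hypotheses (hG : hausdorff_space G) (scG : @second_countable G).
Hypotheses (haarG : haar mG) (uniG : unimodular mG).
Hypothesis sfG : sigma_finite setT mG.
Implicit Types (A B E F J K S T U : set G) (g c : G).
Local Notation v := (vol mG).
Local Notation bd := (bd mG).

Variables (Q : set G) (C Im : R) (f : set G -> R).
Hypotheses (cQ : compact Q) (Q1 : Q 1%g) (C1 : 1 <= C).
Hypothesis f_lip : forall K L, relcompact_borel K -> relcompact_borel L ->
  K `<=` L -> `|f L - f K| <= C * (v (L `\` K) + bd Q L + bd Q K).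
Hypothesis f_subadd : forall n (K : 'I_n -> set G),
  (forall i, relcompact_borel (K i)) -> trivIset setT K ->
  f (\bigcup_i K i) <= \sum_(i < n) f (K i) + C * \sum_(i < n) bd Q (K i).

Section tiling.
Variables (S A P : set G) (kappa : R).
Hypotheses (rS : relcompact_borel S) (rA : relcompact_borel A).
Local Notation tiles := (tiles S).
Local Notation pieces := (pieces S).

Lemma f_subadd_pieces cs : packing mG S A P kappa cs ->
  f A <= f (A `\` tiles cs) + \sum_(p <- pieces cs) f p +
    C * (bd Q (A `\` tiles cs) + \sum_(p <- pieces cs) bd Q p).
Proof.
move=> pcs; pose s := (A `\` tiles cs) :: pieces cs.
have sumE (h : set G -> R) : \sum_(i < size s) h (nth set0 s i) =
    h (A `\` tiles cs) + \sum_(p <- pieces cs) h p.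
  have -> : h (A `\` tiles cs) + \sum_(p <- pieces cs) h p = \sum_(p <- s) h p.
    by rewrite big_cons.
  by rewrite (big_nth set0) big_mkord.
have rs (i : 'I_(size s)) : relcompact_borel (nth set0 s i).
  case: i => -[|i] _ /=; last exact: RK_pieces.
  by apply: RK_setD => //; exact: RK_tiles.
have ts : trivIset setT (fun i : 'I_(size s) => nth set0 s i).
  apply/trivIsetP => i j _ _; wlog ij : i j / (i < j)%N => [wl|].
    rewrite neq_ltn => /orP[ij|ij]; first by apply: wl => //; rewrite neq_ltn ij.
    by rewrite setIC; apply: wl => //; rewrite neq_ltn ij.
  move=> _; case: i j ij => -[|i] _ [[|j] _]//= ij; last exact: pieces_disjoint.
  by rewrite -subset0 => x [[_ nU] /piece_sub_tiles].
have AE : \bigcup_(i : 'I_(size s)) nth set0 s i = A.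
  apply/seteqP; split=> [x [i _]|x Ax].
    case: i => -[|i] _ /= => [[]//|/piece_sub_tiles].
    exact: tiles_sub pcs _.
  have [|nU] := pselect (tiles cs x); last by exists ord0.
  rewrite tilesE => -[i /= il xi].
  have il' : (i.+1 < size s)%N by rewrite /= size_pieces.
  by exists (Ordinal il').
by have := f_subadd rs ts; rewrite AE !sumE.
Qed.

Lemma sum_f_pieces cs (x beta : R) : 0 <= kappa ->
  (forall c, P c -> f (rmul S c) <= x * v S) ->
  bd Q S <= beta * v S -> packing mG S A P kappa cs ->
  \sum_(p <- pieces cs) f p <=
    (size cs)%:R * v S * (x + C * (kappa + beta)) + C * \sum_(p <- pieces cs) bd Q p.
Proof.
move=> k0 Px bS; elim: cs => [_|c cs IH [[Pc cA cU] /IH {}IH]].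
  by rewrite !big_nil !mul0r mulr0 addr0.
rewrite /= !big_cons -natr1.
have rSc := RK_rmul hG c rS; have rU := RK_tiles hG rS cs.
have rP := RK_setD rSc rU.
have /ler_normlP[+ _] := f_lip rP rSc (@subDsetl _ _ _).
rewrite setDD bd_rmul//.
have := Px _ Pc.
have h : C * (v (rmul S c `&` tiles cs) + bd Q S) <= C * (kappa * v S + beta * v S).
  by apply: ler_wpM2l; [have := C1; lra|exact: lerD].
move: h IH; rewrite !mulrDr !mulrDl !mul1r; lra.
Qed.

End tiling.
Hypothesis Im_bound : `|Im| <= 2 * C.
Hypothesis le_Im : forall e : R, 0 < e -> exists K (rho : R),
  [/\ compact K, Q `<=` K, 0 < rho & forall A (a : R), relcompact_borel A ->
    v A <= a -> bd K A <= rho * a -> f A <= Im * v A + e * a].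
Hypothesis near_Im : forall (e : R) K (rho : R), 0 < e -> compact K -> 0 < rho ->
  exists A, almost_invariant mG K rho A /\ (Im - e) * v A < f A.

(** By maximality, a tile S * c with c in P that lies in a translate of T inside
A overlaps the packing in more than the proportion kappa of its volume.  As each
translate of T contains such a tile, the average of the overlaps with translates
of T bounds the volume of the packing from below. *)
Lemma maximal_packing_dense S T A P (kappa z : R) cs :
  relcompact_borel S -> compact T -> T 1%g -> relcompact_borel A ->
  0 < v S -> z * v T <= v S -> 0 < kappa -> 0 < z ->
  bd T A <= 4^-1 * v A -> 0 < v A ->
  (forall h, exists c, rmul S c `<=` rmul T h /\ P c) ->
  (forall c, ~ admissible_tile mG S A P kappa cs c) ->
  kappa * z / 2 * v A <= v (tiles S cs).
Proof.
move=> rS cT T1 rA S0 zTS k0 z0 bT A0 TP mx.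
have rT := RK_compact hG cT.
have fT := RK_finite mG hG rT.
have fU := finite_tiles mG hG rS cs.
have kS0 : 0 < kappa * v S by rewrite mulr_gt0.
have [H [fH vH TH]] := translates_meeting scG haarG uniG sfG kS0 fT fU.
have [|F [fF TF vF]] := bd_lt (mG := mG) hG (r := 2^-1 * v A) cT rA.
  by apply: le_lt_trans bT _; rewrite ltr_pM2r// ltf_pV2 ?posrE// ltr_nat.
have AHF : A `<=` H `|` F.
  move=> h Ah; have [/TF|nTh] := pselect (Kboundary T A h); first by right.
  left; apply: TH.
  have ThA : rmul T h `<=` A.
    move=> x Tx; apply: contrapT => nAx; apply: nTh; split; last by exists x.
    by exists h; split=> //; exists 1%g; rewrite ?mul1g.
  have [c [ScT Pc]] := TP h.
  have : kappa * v S < v (rmul S c `&` tiles S cs).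
    rewrite ltNge; apply/negP => le; apply: (mx c); split=> //.
    exact: subset_trans ScT ThA.
  move/ltW => /le_trans; apply; apply: le_vol; last 2 first.
  - by move=> x [/ScT].
  - by apply: borelI; [exact: (RK_rmul hG c rS).2|exact: fU.1].
  apply: (finite_borel_sub fU) => [x []//|].
  by apply: borelI; [exact: (RK_rmul hG h rT).2|exact: fU.1].
have vA : v A <= v H + v F.
  apply: le_trans (vol_setU_le fH fF).
  by apply: le_vol => //; [exact: finite_borelU|exact: rA.2].
have vHA : 2^-1 * v A <= v H by lra.
have U0 := vol_ge0 mG (tiles S cs).
have h1 : kappa * v S * (2^-1 * v A) <= kappa * v S * v H by rewrite ler_pM2l.
have h2 : z * (v T * v (tiles S cs)) <= v S * v (tiles S cs) by rewrite mulrA ler_wpM2r.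
have h3 : z * (kappa * v S * (2^-1 * v A)) <= z * (v T * v (tiles S cs)).
  by rewrite ler_pM2l//; lra.
rewrite -(ler_pM2l S0); apply: le_trans h2; apply: le_trans h3.
by rewrite le_eqVlt; apply/orP; left; apply/eqP; field.
Qed.

(** A uniform gap below the mean on a set of positive density would push the
mean down.  The point is that K and beta depend on the gap e and on the
proportion z only. *)
Lemma no_dense_gap (e z : R) : 0 < e -> 0 < z -> exists K (beta : R),
  [/\ compact K, 0 < beta & forall S T, relcompact_borel S -> compact T -> T 1%g ->
    0 < v S -> bd K S < beta * v S -> z * v T <= v S ->
    ~ (forall h, exists c, rmul S c `<=` rmul T h /\ f (rmul S c) <= (Im - e) * v S)].
Proof.
move=> e0 z0; have C0 : 0 < C by have := C1; lra.
have eC0 : 0 < e / (40 * C) by rewrite divr_gt0// mulr_gt0.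
have eCE : C * (e / (40 * C)) = e / 40 by field; lra.
(* The overlap kappa is small compared with the gap e, so that disjoining the
   tiles costs less than the gap yields; q is half the resulting gain per unit
   volume of A, the packing covering the proportion kappa * z / 2 of it. *)
pose kappa := Num.min 2^-1 (e / (40 * C)).
have k0 : 0 < kappa by rewrite lt_min eC0 invr_gt0 ltr0n.
have k2 : kappa <= 2^-1 by rewrite ge_min lexx.
have Ck : C * kappa <= e / 40.
  by rewrite -eCE ler_pM2l// ge_min lexx orbT.
pose q := e * kappa * z / 4.
have q0 : 0 < q by rewrite divr_gt0// !mulr_gt0.
have [|K1 [rho1 [cK1 QK1 rho10 fK1]]] := @le_Im (q / 2); first by rewrite divr_gt0.
pose beta := Num.min (rho1 / 4) (e / (40 * C)).
have beta0 : 0 < beta by rewrite lt_min eC0 divr_gt0.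
have Cb : C * beta <= e / 40.
  by rewrite -eCE ler_pM2l// ge_min lexx orbT.
have beta1 : beta <= rho1 / 4 by rewrite ge_min lexx.
exists K1, beta; split=> // S T rS cT T1 S0 bS zTS TP.
pose rho2 := Num.min (rho1 / 2) (q / (4 * C)).
have rho20 : 0 < rho2.
  by rewrite lt_min; apply/andP; split; apply: divr_gt0 => //; rewrite mulr_gt0.
have rho21 : rho2 <= rho1 / 2 by rewrite ge_min lexx.
have Cr : C * rho2 <= q / 4.
  have -> : q / 4 = C * (q / (4 * C)) by field; lra.
  by rewrite ler_pM2l// ge_min lexx orbT.
have [||A [[rA A0 bA] fA]] :=
    @near_Im (q / 2) _ (Num.min rho2 4^-1) _ (compactU cK1 cT).
- by rewrite divr_gt0.
- by rewrite lt_min rho20 invr_gt0 ltr0n.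
have cKT := compactU cK1 cT.
have bdA L s : L `<=` K1 `|` T -> Num.min rho2 4^-1 <= s -> bd L A <= s * v A.
  move=> LKT rs; apply: le_trans (bdS mG hG LKT cKT rA) _.
  by apply: le_trans bA _; rewrite ler_wpM2r// ltW.
have bKA : bd K1 A <= rho2 * v A by apply: bdA => //; rewrite ge_min lexx.
have bTA : bd T A <= 4^-1 * v A by apply: bdA => //; rewrite ge_min lexx orbT.
pose P := [set c | f (rmul S c) <= (Im - e) * v S].
have [|//|cs [pcs mx]] := @maximal_packing _ _ _ hG uniG S A P kappa rS rA.
  by apply: le_lt_trans k2 _; rewrite invf_lt1// ltr1n.
have dense : kappa * z / 2 * v A <= v (tiles S cs).
  exact: (maximal_packing_dense rS cT T1 rA S0 zTS k0 z0 bTA A0 TP mx).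
have [F [fF SF vF]] := bd_lt (mG := mG) hG cK1 rS bS.
have rU := RK_tiles hG rS cs.
have rAU := RK_setD rA rU.
pose D := tile_boundaries F cs.
have fD : finite_borel mG D := finite_tile_boundaries hG uniG fF cs.
pose N := (size cs)%:R * v S.
have nN : 0 <= (size cs)%:R :> R by [].
have vD : v D <= beta * N.
  apply: le_trans (vol_tile_boundaries hG uniG fF cs) _.
  by rewrite /N mulrCA ler_wpM2l// ltW.
have /andP[uN Nu] := vol_tiles hG uniG rS pcs.
rewrite -mulrA -/N in uN; rewrite -/N in Nu.
have UA := tiles_sub pcs.
have ua : v (tiles S cs) <= v A.
  by apply: le_vol => //; [exact: RK_finite|exact: rU.2].
have vAU : v (A `\` tiles S cs) = v A - v (tiles S cs).
  exact: (vol_setD_sub (RK_finite mG hG rA) rU.2 UA).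
have SFQ : Kboundary Q S `<=` F by apply: subset_trans SF; exact: KboundaryS.
have bdQD L : Q `<=` L -> compact L -> Kboundary L S `<=` F ->
    bd L (A `\` tiles S cs) <= bd L A + v D.
  move=> QL cL LF; apply: le_trans (bd_setD mG hG cL rA rU) _.
  by rewrite lerD2l; apply: bd_le => //; exact: (Kboundary_tiles LF).
have sb : \sum_(p <- pieces S cs) bd Q p <= (2 * beta + kappa) * N.
  apply: le_trans (sum_bd_pieces hG uniG rS Q1 fF SFQ pcs fD.1 (@subset_refl _ _)) _.
  have UD : v (tiles S cs `&` D) <= v D.
    by apply: le_vol => //; apply: borelI; [exact: rU.2|exact: fD.1].
  have FN : (size cs)%:R * v F <= beta * N.
    by rewrite /N mulrCA ler_wpM2l// ltW.
  have -> : (size cs)%:R * (v F + kappa * v S) = (size cs)%:R * v F + kappa * N.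
    by rewrite mulrDr mulrCA.
  have -> : (2 * beta + kappa) * N = beta * N + kappa * N + beta * N by ring.
  by apply: lerD (le_trans UD vD); rewrite lerD2r.
have sbK : bd Q (A `\` tiles S cs) <= bd K1 (A `\` tiles S cs) by exact: bdS.
have bU : bd K1 (A `\` tiles S cs) <= rho2 * v A + beta * N.
  by apply: le_trans (bdQD _ QK1 cK1 SF) _; exact: lerD.
have N0 : 0 <= N by rewrite mulr_ge0// ltW.
have N2 : N <= 2 * v (tiles S cs).
  rewrite -ler_pdivrMl//; apply: le_trans uN; apply: ler_wpM2r => //.
  by rewrite lerBrDr -lerBrDl (_ : 1 - 2^-1 = 2^-1)//; field.
have bU1 : bd K1 (A `\` tiles S cs) <= rho1 * v A.
  have bN : beta * N <= rho1 / 4 * (2 * v A).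
    by apply: ler_pM => //; [exact: ltW|apply: le_trans N2 _; rewrite ler_pM2l].
  have rA2 : rho2 * v A <= rho1 / 2 * v A by rewrite ler_pM2r.
  have -> : rho1 * v A = rho1 / 2 * v A + rho1 / 4 * (2 * v A) by field.
  by apply: le_trans bU _; exact: lerD.
have fAU : f (A `\` tiles S cs) <= Im * (v A - v (tiles S cs)) + q / 2 * v A.
  by rewrite -vAU; apply: fK1 => //; rewrite vAU gerBl vol_ge0.
have bSQ : bd Q S <= beta * v S.
  by apply/ltW; apply: le_lt_trans bS; exact: bdS.
have sf := sum_f_pieces rS (ltW k0)
  (fun c Pc => Pc : f (rmul S c) <= (Im - e) * v S) bSQ pcs.
have fle := f_subadd_pieces rS rA pcs.
rewrite -/N in sf.
have : f A <= (Im - q / 2) * v A.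
  apply: (gap_arithmetic C0 (ltW k0) (ltW A0) N0
    Ck Cb Cr Im_bound uN Nu dense _ sf fle fAU sb (le_trans sbK bU) q0) => //.
by rewrite leNgt fA.
Qed.
End mean_gain.

(** * Strong Folner exhaustion sequences *)
Section sequences_to_zero.
Variable R : realType.
Implicit Types u : nat -> R.

Lemma cvg0P u : u m @[m --> \oo] --> (0 : R) <->
  forall e : R, 0 < e -> exists N, forall m, (N <= m)%N -> `|u m| <= e.
Proof.
split=> [/cvgrPdist_le cu e e0|cu].
  by have [N _ uN] := cu e e0; exists N => m /uN; rewrite sub0r normrN.
apply/cvgrPdist_le => e /cu[N uN]; exists N => // m /uN.
by rewrite sub0r normrN.
Qed.

End sequences_to_zero.

Section folner_sequences.
Variables (R : realType) (G : topologicalGroupType) (mG : radonMeasure R G).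
Hypothesis hG : hausdorff_space G.
Implicit Types (A B E F J K S V : set G) (g c : G) (T : nat -> set G).
Local Notation v := (vol mG).
Local Notation bd := (bd mG).

Lemma folner_compact T : strong_folner_exhaustion mG T -> forall m, compact (T m).
Proof. by move=> [[cT _] _ _ _] m; case: (cT m). Qed.

Lemma folner_vol_gt0 T : strong_folner_exhaustion mG T -> forall m, 0 < v (T m).
Proof.
move=> sT m; have rT := RK_compact hG (folner_compact sT (m := m)).
case: sT => [[cT _] _ _ _]; case: (cT m) => _.
by rewrite -(volE (RK_finite mG hG rT)) lte_fin.
Qed.

Lemma folner_boundary T K (rho : R) : strong_folner_exhaustion mG T ->
  compact K -> 0 < rho ->
  exists N, forall m, (N <= m)%N -> bd K (T m) <= rho * v (T m).
Proof.
move=> sT cK rho0; have T0 := folner_vol_gt0 sT.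
case: sT => _ /(_ K cK)/cvg0P/(_ _ rho0)[N bN] _ _.
exists N => m /bN; rewrite ger0_norm; last by rewrite divr_ge0 ?bd_ge0 ?vol_ge0.
by rewrite ler_pdivrMr.
Qed.

Lemma folner_mono T : strong_folner_exhaustion mG T ->
  forall m n, (m <= n)%N -> T m `<=` T n.
Proof.
move=> [_ _ Ti _] m n /subnKC <-; elim: (n - m)%N => [|k IH]; first by rewrite addn0.
by rewrite addnS; apply: subset_trans IH (subset_trans (Ti _).2 (@interior_subset _ _)).
Qed.

Lemma folner_absorb T K : strong_folner_exhaustion mG T -> compact K ->
  exists N, forall m, (N <= m)%N -> K `<=` T m.
Proof.
move=> sT cK; have Tmono := folner_mono sT; have [_ _ Ti TT] := sT.
have {}cK : cover_compact K by rewrite -compact_cover.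
have [n _||D _ KD] := cK nat setT (fun n => (T n)°).
- exact: open_interior.
- move=> x _; have : [set: G] x by [].
  by rewrite -TT => -[n _ /(Ti n).2 Tx]; exists n.+1.
exists (\max_(n <- D) n) => m Dm x /KD[n /= nD /interior_subset].
by apply: Tmono; apply: leq_trans Dm; exact: leq_bigmax_seq.
Qed.

(** The boundary condition alone gives the other clauses of the Folner
property. *)
Lemma strong_folner_of_boundary T :
  (forall m, compact (T m)) -> (forall m, 0 < v (T m)) ->
  (forall K, compact K -> forall rho : R, 0 < rho ->
    exists N, forall m, (N <= m)%N -> bd K (T m) <= rho * v (T m)) ->
  (forall m, T m 1%g /\ T m `<=` (T m.+1)°) -> \bigcup_m T m = setT ->
  strong_folner_exhaustion mG T.
Proof.
move=> cT T0 bT Ti TT.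
have rT m := RK_compact hG (cT m).
split=> //; last first.
  move=> K cK; apply/cvg0P => e e0; have [N bN] := bT K cK e e0; exists N => m /bN.
  rewrite ger0_norm; last by rewrite divr_ge0 ?bd_ge0 ?vol_ge0.
  by rewrite ler_pdivrMr.
split=> [m|K [k Kk] cK].
  by split=> //; rewrite -(volE (RK_finite mG hG (rT m))) lte_fin.
apply/cvg0P => e e0.
have cK1 : compact (invset K `|` [set 1%g]).
  by apply: compactU; [exact: compact_invset|exact: compact_set1].
have [N bN] := bT _ cK1 _ (divr_gt0 e0 (@ltr0Sn _ 1)); exists N => m /bN {}bN.
rewrite ger0_norm; last by rewrite divr_ge0 ?vol_ge0.
rewrite ler_pdivrMr//.
have [|F [fF TF Fr]] := bd_lt (mG := mG) hG (r := e * v (T m)) cK1 (rT m).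
  by apply: le_lt_trans bN _; rewrite ltr_pM2r// ltr_pdivrMr// mulr_natr mulr2n ltrDl.
apply/ltW/(le_lt_trans _ Fr); apply: le_vol => //; last first.
  have bKT : borel_set (prodset K (T m)).
    by apply: borel_compact => //; exact: compact_prodset.
  by apply: borelU; apply: borelD => //; exact: (rT m).2.
apply: subset_trans TF => g [[Tg nKTg]|[[h Kh [x Tx <-]] nT]].
- split; first by exists g; split=> //; exists 1%g; rewrite ?mul1g//; right.
  exists (k^-1 * g)%g; split; first by exists (k^-1)%g => //; left; exists k.
  by move=> Tkg; apply: nKTg; exists k => //; exists (k^-1 * g)%g; rewrite ?mulVKg.
- split; last by exists (h * x)%g; split=> //; exists 1%g; rewrite ?mul1g//; right.
  by exists x; split=> //; exists (h^-1)%g; rewrite ?mulKg//; left; exists h.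
Qed.

Definition erosion V S : set G := [set x | rmul V x `<=` S].

Section erosion.
Variables (V : set G) (T : nat -> set G).
Hypotheses (cV : compact V) (V1 : V 1%g) (sT : strong_folner_exhaustion mG T).

Lemma erosion_sub S : erosion V S `<=` S.
Proof. by move=> x; apply; exists 1%g; rewrite ?mul1g. Qed.

Lemma compact_erosion m : compact (erosion V (T m)).
Proof.
apply: subclosed_compact (folner_compact sT (m := m)) (@erosion_sub _).
have -> : erosion V (T m) = \bigcap_(x in V) lmul (x^-1)%g (T m).
  apply/seteqP; split=> [y Vy x Vx|y Vy _ [x Vx <-]].
    by rewrite lmulE /= invgK; apply: Vy; exists x.
  by have := Vy x Vx; rewrite lmulE /= invgK.
apply: closed_bigI => x _; apply: closed_lmul.
by apply: compact_closed => //; exact: folner_compact.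
Qed.

Lemma vol_erosion S : relcompact_borel S -> relcompact_borel (erosion V S) ->
  v S - bd V S <= v (erosion V S).
Proof.
move=> rS rE; have fS := RK_finite mG hG rS.
apply/ler_addgt0Pr => e e0.
have [|F [fF SF Fr]] := bd_lt (mG := mG) hG (r := bd V S + e) cV rS.
  by rewrite ltrDl.
have : v S <= v (erosion V S `|` F).
  apply: le_vol; [by apply: finite_borelU => //; exact: RK_finite| |exact: rS.2].
  move=> x Sx; have [Ex|nEx] := pselect (erosion V S x); first by left.
  right; apply: SF; split; first by exists x; split=> //; exists 1%g; rewrite ?mul1g.
  by have /existsNP[y /not_implyP[Vy nSy]] := nEx; exists y.
have := vol_setU_le (RK_finite mG hG rE) fF; lra.
Qed.

Lemma Kboundary_erosion K S :
  Kboundary K (erosion V S) `<=` Kboundary (prodset V K) S.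
Proof.
move=> g [[_ [[k Kk <-] Ekg]] [_ [[h Kh <-] nEhg]]]; split.
  exists (k * g)%g; split; last exact: erosion_sub.
  by exists k => //; exists 1%g => //; exists k; rewrite ?mul1g.
have /existsNP[_ /not_implyP[[x Vx <-] nS]] := nEhg.
exists (x * (h * g))%g; split=> //.
by exists (x * h)%g; rewrite ?mulgA//; exists x => //; exists h.
Qed.

(** Shrinking by a fixed compact set only affects the boundary. *)
Lemma strong_folner_erosion : exists N,
  strong_folner_exhaustion mG (fun m => erosion V (T (m + N)%N)) /\
  forall m, (N <= m)%N -> v (T m) <= 2 * v (erosion V (T m)).
Proof.
have rT m := RK_compact hG (folner_compact sT (m := m)).
have rE m := RK_compact hG (@compact_erosion m).
have T0 := folner_vol_gt0 sT.
have [N1 VN1] := folner_absorb sT cV.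
have h2 : 0 < 2^-1 :> R by rewrite invr_gt0 ltr0n.
have [N2 bN2] := folner_boundary sT cV h2.
pose N := maxn N1 N2; exists N.
have vE m : (N <= m)%N -> v (T m) <= 2 * v (erosion V (T m)).
  move=> Nm; have := vol_erosion (rT m) (rE m).
  by have := bN2 m (leq_trans (leq_maxr _ _) Nm); lra.
split=> //; apply: strong_folner_of_boundary.
- by move=> m; exact: compact_erosion.
- by move=> m; have := vE (m + N)%N (leq_addl _ _); have := T0 (m + N)%N; lra.
- move=> K cK rho rho0; have cVK := compact_prodset cV cK.
  have [M bM] := folner_boundary sT cVK (divr_gt0 rho0 (@ltr0Sn _ 1)).
  exists M => m Mm.
  have := bM (m + N)%N (leq_trans Mm (leq_addr _ _)).
  have vEm := vE (m + N)%N (leq_addl _ _).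
  have h : bd K (erosion V (T (m + N)%N)) <= bd (prodset V K) (T (m + N)%N).
    apply/ler_addgt0Pr => e e0.
    have [|F [fF TF /ltW Fr]] := bd_lt (mG := mG) hG
      (r := bd (prodset V K) (T (m + N)%N) + e) cVK (rT (m + N)%N); first by rewrite ltrDl.
    apply: le_trans Fr; apply: bd_le => //; apply: subset_trans TF.
    exact: Kboundary_erosion.
  move=> h'; apply: le_trans h (le_trans h' _).
  rewrite -mulrA ler_pM2l//; lra.
- move=> m; split.
    move=> _ [x Vx <-]; rewrite mulg1; apply: (VN1 (m + N)%N) => //.
    exact: leq_trans (leq_maxl _ _) (leq_addl _ _).
  have oE := open_translates_into cV (@open_interior _ (T (m.+1 + N)%N)).
  have [_ _ Ti _] := sT.
  move=> x Ex; apply: (@interiorS _ [set x | rmul V x `<=` (T (m.+1 + N)%N)°]).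
    by move=> y; move/subset_trans; apply; exact: interior_subset.
  move: oE; rewrite openE => /(_ x); apply => /=.
  by apply: subset_trans Ex _; exact: (Ti _).2.
- apply/seteqP; split=> // x _.
  have [M VM] := folner_absorb sT (@compact_rmul _ x _ cV).
  by exists M => //; apply: VM; exact: leq_addr.
Qed.

End erosion.
End folner_sequences.

(** * Balls of an adapted metric and test functions *)
Section metric_facts.
Variables (R : realType) (G : topologicalGroupType) (d : G -> G -> R).
Hypothesis hG : hausdorff_space G.
Hypothesis dG : continuous_adapted_metric d.

Lemma dxx x : d x x = 0.
Proof. by case: dG => -[d0 _] _ _ _ _; apply/d0. Qed.

Lemma dC x y : d x y = d y x.
Proof. by case: dG => -[_ [dC _]] _ _ _ _. Qed.

Lemma d_triangle x y z : d x z <= d x y + d y z.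
Proof. by case: dG => -[_ [_ dt]] _ _ _ _. Qed.

Lemma d_lmul g x y : d (g * x)%g (g * y)%g = d x y.
Proof. by case: dG => _ dl _ _ _. Qed.

Lemma d_ge0 x y : 0 <= d x y.
Proof. by have := d_triangle x y x; rewrite dxx (dC y x); lra. Qed.

Lemma d_gt0 x y : x <> y -> 0 < d x y.
Proof.
move=> xy; rewrite lt_neqAle d_ge0 andbT; apply/eqP => dxy; apply: xy.
by case: dG => -[d0 _] _ _ _ _; apply/d0.
Qed.

Lemma d_continuous y : continuous (d y).
Proof.
move=> z; case: dG => _ _ _ _ /(_ (y, z)) dc.
apply: (@continuous_comp G (G * G)%type R (fun x => (y, x)) (fun p => d p.1 p.2)) => //.
by apply: cvg_pair => /=; [exact: cvg_cst|exact: cvg_id].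
Qed.

Lemma open_dball y r : open (dball d y r).
Proof.
rewrite (_ : dball d y r = d y @^-1` [set x | x < r])//.
by apply: open_comp => [x _|]; [exact: d_continuous|exact: open_lt].
Qed.

Lemma RK_dball y r : relcompact_borel (dball d y r).
Proof. by split; [case: dG|exact: borel_open (open_dball y r)]. Qed.

Lemma dball_center y r : 0 < r -> dball d y r y.
Proof. by rewrite /dball/= dxx. Qed.

Lemma dball_lmul g y r : dball d (g * y)%g r = lmul g (dball d y r).
Proof.
rewrite lmulE; apply/seteqP; split=> x; rewrite /dball /=.
  by rewrite -{1}(mulVKg g x) d_lmul.
by rewrite -{2}(mulVKg g x) d_lmul.
Qed.

Lemma dballS s y r r' : d s y + r' <= r -> dball d y r' `<=` dball d s r.
Proof. by move=> h x; rewrite /dball/=; have := d_triangle s y x; lra. Qed.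

(** A continuous proper metric induces the topology: on the compact complement
of U in a ball, the distance to x has a positive minimum. *)
Lemma dball_basis x U : open U -> U x -> exists2 r, 0 < r & dball d x r `<=` U.
Proof.
move=> oU Ux; pose L := closure (dball d x 1) `\` U.
have cL : compact L.
  apply: (@subclosed_compact _ _ (closure (dball d x 1))).
  - by apply: closedI; [exact: closed_closure|exact: open_closedC].
  - by rewrite -precompactE; case: dG.
  - exact: subDsetl.
have cdL : compact (d x @` L).
  by apply: continuous_compact => //; apply: continuous_subspaceT; exact: d_continuous.
have : nbhs (0 : R) (~` (d x @` L)).
  apply: open_nbhs_nbhs; split.
    by apply: closed_openC; apply: compact_closed => //; exact: norm_hausdorff.
  move=> [y [_ nUy] dxy]; apply: nUy.
  have [<-//|/d_gt0] := pselect (x = y); by rewrite dxy ltxx.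
move=> /nbhs_ballP[e e0 eL]; have {}e0 : 0 < e by [].
exists (Num.min 1 e); first by rewrite lt_min e0 ltr01.
move=> y; rewrite /dball/= lt_min => /andP[y1 ye]; apply: contrapT => nUy.
apply: (eL (d x y)); first by rewrite /ball/= sub0r normrN ger0_norm// d_ge0.
by exists y => //; split=> //; exact: subset_closure.
Qed.

(** Continuous functions with indicator (B_a s) <= bump s a b <= indicator (B_b s),
through which weak-* closeness controls the masses of balls. *)
Definition bump s (a b : R) (z : G) : R :=
  Num.max 0 (Num.min 1 ((b - d s z) / (b - a))).

Lemma bump_ge0 s a b z : 0 <= bump s a b z.
Proof. by rewrite /bump le_max lexx. Qed.

Lemma bump_le1 s a b z : bump s a b z <= 1.
Proof. by rewrite /bump ge_max ler01 ge_min lexx. Qed.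

Lemma bump1 s a b z : a < b -> dball d s a z -> bump s a b z = 1.
Proof.
move=> ab; rewrite /dball/= => sz.
have h : 1 <= (b - d s z) / (b - a) by rewrite ler_pdivlMr ?subr_gt0//; lra.
by rewrite /bump (min_idPl h) (max_idPr ler01).
Qed.

Lemma bump0 s a b z : a < b -> ~ dball d s b z -> bump s a b z = 0.
Proof.
move=> ab; rewrite /dball/= => /negP; rewrite -leNgt => sz.
have h : (b - d s z) / (b - a) <= 0 by rewrite ler_pdivrMr ?subr_gt0//; lra.
by rewrite /bump; apply/max_idPl; rewrite ge_min h orbT.
Qed.

Lemma bump_continuous s a b : continuous (bump s a b).
Proof.
move=> z.
pose f : G -> R^o := fun z => (b - d s z) / (b - a).
have cf : {for z, continuous f}.
  apply: cvgM; last exact: cvg_cst.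
  by apply: cvgB; [exact: cvg_cst|exact: d_continuous].
have c1 : {for z, continuous (cst 1 : G -> R^o)} by exact: cvg_cst.
have c0 : {for z, continuous (cst 0 : G -> R^o)} by exact: cvg_cst.
exact: (continuous_max c0 (continuous_min c1 cf)).
Qed.

Lemma bump_Cc s a b : a < b -> @Cc R G (bump s a b).
Proof.
move=> ab; split; first exact: bump_continuous.
apply: (@subclosed_compact _ _ (closure (dball d s b))).
- exact: closed_closure.
- by rewrite -precompactE; case: dG.
- apply: closureS => z /=; apply: contra_neqP; exact: bump0.
Qed.

Lemma bump_measurable s a b :
  measurable_fun [set: borel G] (bump s a b : borel G -> R).
Proof.
apply: (measurability _ (RGenOpens.measurableE R)) => _ [_ [x [y ->]] <-].
rewrite setTI; apply: borel_open; apply: open_comp => [z _|]; first exact: bump_continuous.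
exact: interval_open.
Qed.

Lemma bump_integral (mu : radonMeasure R G) s a b : a < b ->
  fine (mu (dball d s a)) <= (\int[mu]_x bump s a b x)%R <= fine (mu (dball d s b)).
Proof.
move=> ab; rewrite /Rintegral.
have ba c : measurable (dball d s c : set (borel G)) by exact: borel_open (open_dball s c).
have fb c := finite_borel_fin_num (RK_finite mu hG (RK_dball s c)).
have mb : measurable_fun [set: borel G] (EFin \o (bump s a b : borel G -> R)).
  by apply/measurable_EFinP; exact: bump_measurable.
have b0 (x : borel G) : (0 <= (bump s a b x)%:E)%E by rewrite lee_fin bump_ge0.
have h1 : (mu (dball d s a) <= \int[mu]_x (bump s a b x)%:E)%E.
  rewrite -[X in (mu X <= _)%E]setIT -integral_indic//.
  apply: ge0_le_integral => //.
  - by apply/measurable_EFinP; exact: measurable_indic.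
  - move=> x _; rewrite lee_fin indicE.
    have [/set_mem xa|_] := boolP (_ \in _); last exact: bump_ge0.
    by rewrite (bump1 ab xa).
have h2 : (\int[mu]_x (bump s a b x)%:E <= mu (dball d s b))%E.
  rewrite -[X in (_ <= mu X)%E]setIT -integral_indic//.
  apply: ge0_le_integral => //.
  - by apply/measurable_EFinP; exact: measurable_indic.
  - move=> x _; rewrite lee_fin indicE.
    have [_|/negP xb] := boolP (_ \in _); first exact: bump_le1.
    by rewrite (bump0 ab)// => xb'; apply: xb; rewrite inE.
have hf : (\int[mu]_x (bump s a b x)%:E)%E \is a fin_num.
  rewrite ge0_fin_numE ?integral_ge0//; apply: le_lt_trans h2 _.
  by rewrite -ge0_fin_numE.
by rewrite -!lee_fin !fineK// h1.
Qed.

Lemma radon_eval_continuous (f : G -> R) : @Cc R G f ->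
  continuous (fun mu : radonMeasure R G => (\int[mu]_x f x)%R : R).
Proof.
move=> cf; pose i : set_type (@Cc R G) := SigSub (mem_set cf).
move=> mu.
apply: (@continuous_comp _ {ptws set_type (@Cc R G) -> R} _ (@radon_eval R G) (fun h => h i)).
  exact: initial_continuous.
exact: proj_continuous.
Qed.
End metric_facts.

(** * Approximation of the hull by the orbit *)
Section hull_approximation.
Variables (R : realType) (G : topologicalGroupType) (d : G -> G -> R).
Hypothesis hG : hausdorff_space G.
Hypothesis dG : continuous_adapted_metric d.
Local Notation B := (dball d).

Lemma comb_pos (M : weightedDelone R G) (A : set G) : borel_set A ->
  (0 < dirac_comb M A)%E -> exists2 x, wd_set M x & A x.
Proof.
move=> bA; apply: contraPP => /forall2NP nx /=.
rewrite /comb asboolT// (_ : wd_set M `&` A = set0) ?esum_set0 ?ltxx//.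
by rewrite -subset0 => x [Px Ax]; case: (nx x).
Qed.

Lemma comb_one (M : weightedDelone R G) (A : set G) x : borel_set A ->
  wd_set M x -> A x -> (forall y, wd_set M y -> A y -> y = x) ->
  dirac_comb M A = (wd_weight M x)%:E.
Proof.
move=> bA Px Ax xU /=; rewrite /comb asboolT//.
have -> : wd_set M `&` A = [set x].
  by apply/seteqP; split=> [y [Py Ay]|_ ->//]; exact: xU.
rewrite esum_set1// lee_fin; have [s s1 /(_ x Px)/andP[+ _]] := wd_bounded M.
by apply: le_trans; rewrite invr_ge0; lra.
Qed.

Section one_delone.
Variable Lam : weightedDelone R G.
Local Notation orb g := (dirac_comb (wd_translate g Lam)).

(** Translates of the open set U of the Delone property contain translates of a
ball, so every ball of that radius contains at most one atom of the orbit. *)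
Lemma uniform_separation : exists2 r : R, 0 < r & forall g s x y,
  lmul g (wd_set Lam) x -> lmul g (wd_set Lam) y -> B s r x -> B s r y -> x = y.
Proof.
have [[U [[u Uu] oU _ UP]] _] := wd_delone Lam.
have [r r0 rU] := dball_basis dG oU Uu; exists r => // g s.
move=> _ _ [x Px <-] [y Py <-] sx sy; congr (g * _)%g.
have tU z : B s r (g * z)%g -> lmul (g^-1 * s * u^-1)%g U z.
  have -> : s = (g * (g^-1 * s * u^-1) * u)%g by rewrite !mulgA mulgV mul1g mulgVK.
  rewrite dball_lmul// lmulE /= => /rU; rewrite lmulE /=.
  by rewrite !invgM !invgK !mulgA !mulgVK ?mulgV ?mul1g ?mulgK.
by apply: (UP (g^-1 * s * u^-1)%g); split=> //; exact: tU.
Qed.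

Lemma uniform_weights : exists2 sg : R, 0 < sg & forall g x,
  lmul g (wd_set Lam) x -> sg <= wd_weight (wd_translate g Lam) x.
Proof.
have [s s1 sP] := wd_bounded Lam; exists s^-1; first by rewrite invr_gt0; lra.
by move=> g _ [x /sP/andP[sx _] <-] /=; rewrite mulKg.
Qed.

(** Weak-* closeness on finitely many bump functions, read off on balls at the
price of a slightly larger radius. *)
Lemma hull_near_orbit Pi (kappa tau : R) (D : seq (G * nat)) :
  hull Lam Pi -> 0 < kappa -> 0 < tau ->
  exists g, forall p, p \in D ->
    fine (orb g (B p.1 (p.2%:R * kappa))) <=
      fine (Pi (B p.1 (p.2.+1%:R * kappa))) + tau /\
    fine (Pi (B p.1 (p.2%:R * kappa))) <=
      fine (orb g (B p.1 (p.2.+1%:R * kappa))) + tau.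
Proof.
move=> hPi k0 t0.
have near_D : \forall mu \near Pi, forall p, p \in D ->
    fine ((mu : radonMeasure R G) (B p.1 (p.2%:R * kappa))) <=
      fine (Pi (B p.1 (p.2.+1%:R * kappa))) + tau /\
    fine (Pi (B p.1 (p.2%:R * kappa))) <=
      fine (mu (B p.1 (p.2.+1%:R * kappa))) + tau.
  elim: D => [|p D IH]; first by apply: (@filterE _ (nbhs Pi)) => mu p; rewrite in_nil.
  have ab : p.2%:R * kappa < p.2.+1%:R * kappa by rewrite ltr_pM2r// ltr_nat.
  have /cvgrPdist_lt/(_ _ t0) close := @radon_eval_continuous _ _ _ (bump_Cc dG p.1 ab) Pi.
  apply: filterS2 IH close => mu IH muPi q; rewrite inE => /orP[/eqP ->|]; last exact: IH.
  have /andP[m1 m2] := bump_integral hG dG mu p.1 ab.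
  have /andP[p1 p2] := bump_integral hG dG Pi p.1 ab.
  move: muPi; rewrite ltr_norml => /andP[l1 l2]; clear -hG dG Lam m1 m2 p1 p2 l1 l2.
  by split; lra.
by have [mu [[g _ <-] Dg]] := hPi _ near_D; exists g.
Qed.

(** Every element of the hull is close to the orbit on a compact set S, for the
distance that compares masses of balls around points of the supports.  With a
finite kappa-net of S and radii that are multiples of kappa, the masses of
balls of the two measures are sandwiched between each other; in the orbit, a
small ball carries no mass or exactly one atom. *)
Lemma hull_measure_dist Pi (S : set G) (delta : R) :
  hull Lam Pi -> compact S -> 0 < delta ->
  exists g, (measure_dist d S Pi (orb g) <= delta%:E)%E.
Proof.
move=> hPi cS delta0.
have [r r0 sep] := uniform_separation; have [sg sg0 wsg] := uniform_weights.
pose kappa := Num.min (r / 8) (delta / 6).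
have k0 : 0 < kappa by rewrite lt_min !divr_gt0.
have kr : 8 * kappa <= r.
  have : kappa <= r / 8 by rewrite ge_min lexx.
  lra.
have kd : 6 * kappa <= delta.
  have : kappa <= delta / 6 by rewrite ge_min lexx orbT.
  lra.
have fB (mu : radonMeasure R G) s a : mu (B s a) \is a fin_num.
  exact: finite_borel_fin_num (RK_finite mu hG (RK_dball dG s a)).
have bB s a : borel_set (B s a) by case: (RK_dball dG s a).
have fle (mu : radonMeasure R G) s a y b : d s y + b <= a ->
    fine (mu (B y b)) <= fine (mu (B s a)).
  move=> sy; apply: fine_le => //; apply: le_measure; rewrite ?inE; [exact: bB..|].
  exact: dballS.
have atom g s a : 0 < fine (orb g (B s a)) -> exists2 x, lmul g (wd_set Lam) x & B s a x.
  move=> p; apply: (comb_pos (M := wd_translate g Lam)) => //.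
  by rewrite -[X in (_ < X)%E]fineK// lte_fin.
have one g s a x : lmul g (wd_set Lam) x -> B s a x -> a <= r ->
    fine (orb g (B s a)) = wd_weight (wd_translate g Lam) x.
  move=> Px Bx ar; rewrite (comb_one (M := wd_translate g Lam) (x := x))// => y Py By.
  by apply: (sep g s) => //; apply: (lt_le_trans _ ar); [exact: By|exact: Bx].
(* Less than half of the least mass of an atom, so that positive masses are
   recognized, and less than the radius 6 * kappa. *)
pose tau := Num.min kappa (sg / 4).
have t0 : 0 < tau by rewrite lt_min k0 divr_gt0.
have tk : tau <= kappa by rewrite ge_min lexx.
have ts : tau <= sg / 4 by rewrite ge_min lexx orbT.
have {}cS : cover_compact S by rewrite -compact_cover.
have [s _||D _ SD] := cS G setT (fun s => B s kappa); first exact: open_dball.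
  by move=> x _; exists x => //; exact: dball_center.
pose L := [seq (s, j) | s <- enum_fset D, j <- iota 0 8].
have [g gL] := hull_near_orbit L hPi k0 t0.
have {}gL s j : s \in D -> (j < 8)%N ->
    fine (orb g (B s (j%:R * kappa))) <= fine (Pi (B s (j.+1%:R * kappa))) + tau /\
    fine (Pi (B s (j%:R * kappa))) <= fine (orb g (B s (j.+1%:R * kappa))) + tau.
  by move=> sD j8; apply: (gL (s, j)); apply: allpairs_f => //; rewrite mem_iota.
exists g; apply: (@le_trans _ _ (6 * kappa)%:E); last by rewrite lee_fin.
apply: ereal_inf_lbound; exists (6 * kappa) => //; split; first by rewrite mulr_gt0.
move=> y Sy yPi; have [s /= sD sy] := SD y Sy; rewrite /dball/= in sy.
have supp_pos (mu : radonMeasure R G) : msupp mu y -> 0 < fine (mu (B s (1 * kappa))).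
  move=> ym; rewrite mul1r -lte_fin fineK//; apply: ym => //.
  exact: open_dball.
(* A support point of Pi near s forces a mass of Pi bounded below, through
   an auxiliary orbit element h that need not be close to orb g elsewhere. *)
have [x Px sx] : exists2 x, lmul g (wd_set Lam) x & B s (4 * kappa) x.
  apply: (atom g s (4 * kappa)); case: yPi => /supp_pos p; last first.
    by apply: lt_le_trans p _; apply: fle; rewrite (dxx dG); clear -hG dG Lam k0; lra.
  have t1 : 0 < Num.min (fine (Pi (B s (1 * kappa))) / 2) (sg / 2).
    by rewrite lt_min !divr_gt0.
  have [h hL] := hull_near_orbit [:: (s, 1%N); (s, 2%N)] hPi k0 t1.
  have [_ h1] := hL (s, 1%N) (mem_head _ _).
  have [h2 _] : _ /\ _ := hL (s, 2%N) (mem_last _ [:: (s, 2%N)]).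
  rewrite /= in h1 h2.
  have m1 : Num.min (fine (Pi (B s (1 * kappa))) / 2) (sg / 2) <=
      fine (Pi (B s (1 * kappa))) / 2.
    by rewrite ge_min lexx.
  have m2 : Num.min (fine (Pi (B s (1 * kappa))) / 2) (sg / 2) <= sg / 2.
    by rewrite ge_min lexx orbT.
  have [|x Px sx] := atom h s (2 * kappa); first by clear -hG dG Lam h1 m1 p; lra.
  have := wsg h x Px; rewrite -(one h s (2 * kappa) x)//; last by clear -hG dG Lam kr k0; lra.
  have [_ h3] := gL s 3%N sD isT => h4.
  by clear -hG dG Lam h2 m2 ts sg0 h3 h4; lra.
have w5 := one g s (5 * kappa) x Px; have w8 := one g s (8 * kappa) x Px.
have w6 := one g y (6 * kappa) x Px.
have sx5 : B s (5 * kappa) x.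
  by apply: (dballS dG _ sx); rewrite (dxx dG); clear -hG dG Lam k0; lra.
have sx8 : B s (8 * kappa) x.
  by apply: (dballS dG _ sx); rewrite (dxx dG); clear -hG dG Lam k0; lra.
have yx6 : B y (6 * kappa) x.
  by apply: (dballS dG _ sx); rewrite (dC dG); clear -hG dG Lam sy k0; lra.
have sx4 := one g s (4 * kappa) x Px sx.
have [h1 _] := gL s 4%N sD isT; have [_ h2] := gL s 7%N sD isT.
have h3 : fine (Pi (B s (5 * kappa))) <= fine (Pi (B y (6 * kappa))).
  by apply: fle; rewrite (dC dG); clear -hG dG Lam sy k0; lra.
have h4 : fine (Pi (B y (6 * kappa))) <= fine (Pi (B s (7 * kappa))).
  by apply: fle; clear -hG dG Lam sy k0; lra.
rewrite -[Pi _]fineK// -[orb g _]fineK// -EFinB abse_EFin lte_fin w6//; last first.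
  by clear -hG dG Lam kr k0; lra.
rewrite sx4 in h1; last by clear -hG dG Lam kr k0; lra.
rewrite w8 in h2 => //.
by rewrite ltr_norml; clear -hG dG Lam h1 h2 h3 h4 tk k0; apply/andP; split; lra.
Qed.

End one_delone.
End hull_approximation.

(** * Occurrences of patterns *)
Section patterns.
Variables (R : realType) (G : topologicalGroupType) (d : G -> G -> R).
Variables (mG : radonMeasure R G) (Lam : weightedDelone R G).
Hypothesis dG : continuous_adapted_metric d.
Local Notation B := (dball d).
Local Notation orb g := (dirac_comb (wd_translate g Lam)).

Definition unit_ball : set G := closure (B 1%g 1).

Lemma compact_unit_ball : compact unit_ball.
Proof. by rewrite /unit_ball -precompactE; case: dG. Qed.

Lemma unit_ball1 : unit_ball 1%g.
Proof. by apply: subset_closure; apply: (dball_center dG). Qed.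

(** Inversion turns the right translate of the ball by x, which lies in S, into
the ball around the inverse of x. *)
Lemma erosion_unit_ball S x y : erosion unit_ball S x -> B x^-1%g 1 y ->
  invset S° y.
Proof.
move=> Ex xy; rewrite invsetE /=.
have oB : open (rmul (B 1%g 1) x) by apply: open_rmul; exact: (open_dball dG).
apply: (@interiorS _ (rmul (B 1%g 1) x)).
  by apply: subset_trans Ex; apply: rmulS; exact: subset_closure.
apply: open_nbhs_nbhs; split=> //.
exists (y^-1 * x^-1)%g; last by rewrite mulgVK.
by rewrite /dball/= -(d_lmul dG y) mulg1 mulVKg (dC dG).
Qed.

Lemma orbE g (A : set G) : orb g A = dirac_comb Lam ((fun x => (g * x)%g) @^-1` A).
Proof. by rewrite dirac_comb_translate. Qed.

(** Patches are restrictions, so that masses of balls that stick out of the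
support of the patch are not controlled.  Shrinking the support by a unit ball
turns the occurrence of a pattern into closeness of the unrestricted
measures. *)
Lemma repetitive_measure_dist (T : nat -> set G) (delta : R) m n k h :
  delta <= 1 -> repetitive_at d Lam T delta m n ->
  exists c, rmul (erosion unit_ball (T m)) c `<=` rmul (T n) h /\
    (measure_dist d (invset (erosion unit_ball (T m))) (orb k) (orb c) <= delta%:E)%E.
Proof.
move=> delta1 rep; pose S0 := invset (T m)°.
have inT : patterns_of_size Lam S0
    (pattern_of (patch_of (dirac_comb Lam) (lmul (k^-1)%g S0))).
  by exists (k^-1)%g.
have [_ [g1 _ <-] [g []]] := rep _ inT (h^-1)%g.
rewrite /= !lmulM; set a := (g * g1 * k^-1)%g => gT.
move=> /ereal_inf_lt[_ [rho [rho0 rhoP] <-]]; rewrite lte_fin => rho_delta.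
have BS0 x y : erosion unit_ball (T m) x -> B x^-1%g rho y -> S0 y.
  by move=> Ex xy; apply: (erosion_unit_ball Ex); apply: lt_trans xy _; lra.
have oS0 : open S0 by apply: open_invset; exact: open_interior.
exists (a^-1)%g; split.
  have ES0 : erosion unit_ball (T m) `<=` (T m)°.
    move=> x Ex; have := BS0 x (x^-1)%g Ex (dball_center dG _ rho0).
    by rewrite /S0 invsetE /= invgK.
  apply: (@subset_trans _ (rmul (T n)° h)); last by apply: rmulS; exact: interior_subset.
  apply: (subset_trans (rmulS ES0)) => x xS.
  have := gT (x^-1)%g; rewrite /S0 !lmul_invset !invsetE /= !invgK.
  by apply.
apply: (@le_trans _ _ rho%:E); last by rewrite lee_fin; exact: ltW.
apply: ereal_inf_lbound; exists rho => //; split=> // z [x Ex <-] zs.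
pose y := (a * x^-1)%g.
have Sx : S0 (x^-1)%g by apply: (BS0 x) => //; exact: dball_center.
have Wy : lmul a S0 y by exists (x^-1)%g.
have m1E (A : set G) :
    lpush g (lpush g1 (restr (dirac_comb Lam) (lmul (k^-1)%g S0))) (lmul a A) =
    orb k (A `&` S0).
  rewrite orbE /lpush /restr; congr (dirac_comb Lam _).
  rewrite !lmulE; apply/seteqP; split=> u /=; rewrite /a !invgM !invgK.
    by rewrite -!mulgA !mulKg.
  by rewrite -!mulgA !mulKg.
have m2E (A : set G) : restr (dirac_comb Lam) (lmul a S0) (lmul a A) =
    orb (a^-1)%g (A `&` S0).
  by rewrite orbE /restr -lmulI lmulE.
have aK (U : set G) : lmul a (lmul (a^-1)%g U) = U.
  by rewrite lmulM mulgV lmulE invg1; apply/seteqP; split=> u /=; rewrite mul1g.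
have supp12 : (msupp (lpush g (lpush g1 (restr (dirac_comb Lam) (lmul (k^-1)%g S0))))
    `|` msupp (restr (dirac_comb Lam) (lmul a S0))) y.
  case: zs => zs; [left|right] => U oU Uy.
    rewrite -(aK U).
    rewrite m1E; apply: zs; first by apply: openI => //; exact: open_lmul.
    by split=> //; rewrite lmulE /= invgK.
  rewrite -(aK U).
  rewrite m2E; apply: zs; first by apply: openI => //; exact: open_lmul.
  by split=> //; rewrite lmulE /= invgK.
have := rhoP y Wy supp12.
rewrite (dball_lmul dG) m1E m2E (_ : B (x^-1)%g rho `&` S0 = B (x^-1)%g rho)//.
by apply: setIidl => u; exact: BS0.
Qed.

Lemma zeta_repetitive (T : nat -> set G) (delta : R) : (forall m, 0 < vol mG (T m)) ->
  0 < zeta d mG Lam T delta -> forall m, exists n, repetitive_at d Lam T delta m n /\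
    zeta d mG Lam T delta * vol mG (T n) <= vol mG (T m).
Proof.
move=> T0; rewrite /zeta; case: ifPn => [|/asboolPn nNone _ m]; first by rewrite ltxx.
have [n rn] : exists n, repetitivity d Lam T delta m = Some n.
  case E: repetitivity => [n|]; first by exists n.
  by exfalso; apply: nNone; exists m.
exists n; split.
  move: rn; rewrite /repetitivity; case: pselect => // e [<-].
  by case: ex_minnP => k /asboolP.
rewrite -ler_pdivlMr//; apply: ge_inf; last by exists m => //; rewrite rn.
by exists 0 => _ [j _ <-]; rewrite divr_ge0 ?vol_ge0.
Qed.

End patterns.

(** * The limit along a Folner sequence *)
(** Here t and s are the volumes of a set and of its erosion, W and ws the
weights of a deviating patch there, wc the weight at a similar patch and fc its
translate back to the reference configuration. *)
Lemma lower_arithmetic (R : realFieldType)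
    (C gamma e t s bV bT bS I W ws wc fc : R) :
  0 < C -> 0 < gamma -> C * gamma = e / 72 -> t <= 2 * s -> 0 <= s -> s <= t ->
  t - bV <= s -> bV <= gamma * t -> bT <= gamma * t -> bS <= gamma * s ->
  0 <= e -> `|I| <= 2 * C -> W <= (I - e) * t ->
  - (W - ws) <= C * (t - s + bT + bS) -> wc - ws <= e / 8 * s ->
  - (wc - fc) <= C * bS -> fc <= (I - e / 2) * s.
Proof.
move=> C0 g0 gC ts s0 st tV bVg bTg bSg e0 IC We l1 l2 l3.
have gt : gamma * t <= gamma * (2 * s) by rewrite ler_pM2l.
have l4 : C * (t - s + bT + bS) <= C * (gamma * (5 * s)) by rewrite ler_pM2l//; lra.
have l5 : C * bS <= C * (gamma * s) by rewrite ler_pM2l.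
have l6 : (I - e) * (t - s) <= 2 * C * (gamma * (2 * s)).
  apply: (@le_trans _ _ (2 * C * (t - s))).
    by apply: ler_wpM2r; [lra|move/ler_normlP: IC => [_]; lra].
  by rewrite ler_pM2l ?mulr_gt0//; lra.
have gs : C * (gamma * (5 * s)) = 5 * (e / 72 * s) by rewrite mulrA gC; ring.
have gs1 : C * (gamma * s) = e / 72 * s by rewrite mulrA gC.
have gs2 : 2 * C * (gamma * (2 * s)) = 4 * (e / 72 * s).
  by rewrite -mulrA (mulrA C) gC; ring.
rewrite gs in l4; rewrite gs1 in l5; rewrite gs2 in l6.
have es : 0 <= e * s by rewrite mulr_ge0.
lra.
Qed.

Section admissible_weights.
Variables (R : realType) (G : topologicalGroupType) (mG : radonMeasure R G).
Variables (d : G -> G -> R) (Lam : weightedDelone R G).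
Variable w : set G -> radonMeasure R G -> R.
Hypotheses (hG : hausdorff_space G) (scG : @second_countable G).
Hypotheses (haarG : haar mG) (uniG : unimodular mG).
Hypothesis dG : continuous_adapted_metric d.
Local Notation v := (vol mG).
Local Notation bd := (bd mG).
Local Notation orb g := (dirac_comb (wd_translate g Lam)).

Lemma hull_orbit g : hull Lam (orb g).
Proof. by apply: subset_closure; exists g. Qed.

Lemma hull_self : hull Lam (dirac_comb Lam).
Proof.
have <- : orb 1%g = dirac_comb Lam; last exact: hull_orbit.
rewrite dirac_comb_translate; apply: radonP => A _ /=; rewrite /lpush.
by congr (comb Lam _); apply/seteqP; split=> x /=; rewrite mul1g.
Qed.

Lemma orbit_back g : radon_act (g^-1)%g (orb g) = dirac_comb Lam.
Proof.
rewrite dirac_comb_translate; apply: radonP => A _ /=; rewrite /lpush.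
by congr (comb Lam _); apply/seteqP; split=> x /=; rewrite mulKg.
Qed.

(** The three quantitative conditions on w with a single compact set and a
single constant, in terms of real numbers. *)
Definition controlled_weight (Q : set G) (C : R) : Prop :=
  [/\ compact Q, Q 1%g, 1 <= C,
   [/\ forall x K L, hull Lam x -> relcompact_borel K -> relcompact_borel L ->
    K `<=` L -> `|w L x - w K x| <= C * (v (L `\` K) + bd Q L + bd Q K),
   forall n (K : 'I_n -> set G) x, hull Lam x ->
    (forall i, relcompact_borel (K i)) -> trivIset setT K ->
    w (\bigcup_i K i) x <= \sum_(i < n) w (K i) x + C * \sum_(i < n) bd Q (K i) &
   forall K g, relcompact_borel K ->
    `|w K (orb g) - w (rmul K g) (dirac_comb Lam)| <= C * bd Q K] &
   w set0 (dirac_comb Lam) = 0].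

Lemma admissible_controlled : admissible mG d Lam w ->
  exists Q C, controlled_weight Q C.
Proof.
move=> [W1 [J [cJ [eta [eta0 W2]]]] [B [cB [theta [theta0 W3]]]]
  [I [cI [iota [iota0 W4]]]] _].
pose Q := J `|` (B `|` (I `|` [set 1%g])).
have cQ : compact Q by do 3 (apply: compactU => //); exact: compact_set1.
pose C := 1 + eta + theta + iota.
exists Q, C; split=> //.
- by right; right; right.
- by rewrite /C; lra.
- split=> [x K L hx rK rL KL|n K x hx rK tK|K g rK].
  + have := W2 x K L hx rK rL KL.
    have fLK := RK_finite mG hG (RK_setD rL rK).
    rewrite -(volE fLK) -!(bdvolE mG hG cJ)// -!EFinD -EFinM lee_fin => /le_trans; apply.
    have JQ : J `<=` Q by left.
    have b1 := bdS mG hG JQ cQ rL; have b2 := bdS mG hG JQ cQ rK.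
    have := vol_ge0 mG (L `\` K); have := bd_ge0 mG J L; have := bd_ge0 mG J K.
    move=> h1 h2 h3; apply: (@le_trans _ _ (eta * (v (L `\` K) + bd Q L + bd Q K))).
      by rewrite ler_pM2l//; lra.
    by apply: ler_wpM2r; [lra|rewrite /C; lra].
  + have := W3 n K x hx rK tK.
    under [X in (_ + _ * X)%E]eq_bigr => i _ do rewrite -(bdvolE mG hG cB (rK i)).
    rewrite !sumEFin -EFinM -EFinD lee_fin => /le_trans; apply; rewrite lerD2l.
    apply: (@le_trans _ _ (theta * \sum_(i < n) bd Q (K i))).
      apply: ler_wpM2l => //; apply: ler_sum => i _.
      by apply: bdS => // y; right; left.
    apply: ler_wpM2r; first by apply: sumr_ge0 => i _; exact: bd_ge0.
    by rewrite /C; lra.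
  + have := W4 _ K (g^-1)%g (@hull_orbit g) rK.
    rewrite invgK orbit_back -(bdvolE mG hG cI rK) -EFinM lee_fin => /le_trans; apply.
    have b : bd I K <= bd Q K by apply: bdS => // y; right; right; left.
    apply: (@le_trans _ _ (iota * bd Q K)); first exact: ler_wpM2l.
    by apply: ler_wpM2r; [exact: bd_ge0|rewrite /C; lra].
- exact: W1 hull_self.
Qed.

Lemma sigma_finite_mG : sigma_finite setT mG.
Proof.
exists (fun n => dball d 1%g n%:R).
  apply/seteqP; split=> // x _.
  have [n nx] : exists n : nat, d 1%g x < n%:R.
    by exists (Num.trunc (d 1%g x)).+1; rewrite truncnS_gt.
  by exists n.
move=> n; have [bB Boo] := RK_finite mG hG (RK_dball dG 1%g n%:R).
by split.
Qed.

Section limit.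
Variables (Q : set G) (C : R).
Hypothesis wQC : controlled_weight Q C.
Local Notation f := (fun A => w A (dirac_comb Lam)).
Local Notation Im := (asymptotic_mean mG f).

Lemma weight_translate K g : relcompact_borel K ->
  `|w K (orb g) - w (rmul K g) (dirac_comb Lam)| <= C * bd Q K.
Proof. by case: wQC => _ _ _ [_ _ wt] _; exact: wt. Qed.

Variable T : nat -> set G.
Hypothesis sT : strong_folner_exhaustion mG T.

Lemma folner_almost_invariant K (rho : R) : compact K -> 0 < rho ->
  exists A, almost_invariant mG K rho A.
Proof.
move=> cK rho0; have [N bN] := folner_boundary hG sT cK rho0.
exists (T N); split; last exact: bN.
  by apply: RK_compact => //; exact: (folner_compact sT).
exact: (folner_vol_gt0 hG sT).
Qed.

Let rT m : relcompact_borel (T m).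
Proof. by apply: RK_compact => //; exact: (folner_compact sT). Qed.

Lemma mean_data : [/\ `|Im| <= 2 * C,
  forall e : R, 0 < e -> exists K (rho : R),
    [/\ compact K, Q `<=` K, 0 < rho & forall A (a : R), relcompact_borel A ->
    v A <= a -> bd K A <= rho * a -> f A <= Im * v A + e * a] &
  forall (e : R) K (rho : R), 0 < e -> compact K -> 0 < rho ->
  exists A, almost_invariant mG K rho A /\ (Im - e) * v A < f A].
Proof.
case: wQC => cQ Q1 C1 [wl ws wt] w0.
have fl K L := wl _ K L hull_self.
split.
- exact: (asymptotic_mean_bound hG cQ C1 w0 fl folner_almost_invariant).
- move=> e e0; exact: (le_mean hG cQ C1 w0 fl folner_almost_invariant e0).
- move=> e K rho e0 cK r0.
  exact: (near_mean_ex hG cQ C1 w0 fl folner_almost_invariant e0 cK r0).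
Qed.

(** Right translation preserves volumes of sets and of boundaries, so that all
translates of T m are equally close to their common bound. *)
Lemma mean_upper (e : R) : 0 < e -> exists N, forall m k, (N <= m)%N ->
  w (T m) (orb k) <= (Im + e) * v (T m).
Proof.
move=> e0; have [_ leI _] := mean_data.
case: (wQC) => cQ Q1 C1 _ _.
have e2 : 0 < e / 2 by rewrite divr_gt0.
have [K [rho [cK QK rho0 fK]]] := leI _ e2.
pose sigma := Num.min rho (e / (2 * C)).
have s0 : 0 < sigma by rewrite lt_min rho0 divr_gt0// mulr_gt0//; lra.
have [N bN] := folner_boundary hG sT cK s0; exists N => m k /bN bm.
have v0 := vol_ge0 mG (T m).
have bQ : bd Q (T m) <= sigma * v (T m) by apply: le_trans bm; exact: bdS.
have /ler_normlP[_ wt] := weight_translate k (rT m).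
have : f (rmul (T m) k) <= Im * v (T m) + e / 2 * v (T m).
  rewrite -(vol_rmul uniG k (rT m).2); apply: fK => //; first exact: RK_rmul.
  rewrite (bd_rmul hG uniG)// (vol_rmul uniG); last exact: (rT m).2.
  by apply: le_trans bm _; rewrite ler_wpM2r// ge_min lexx.
have : C * bd Q (T m) <= e / 2 * v (T m).
  have -> : e / 2 = C * (e / (2 * C)) by field; lra.
  rewrite -mulrA ler_pM2l; last by lra.
  by apply: le_trans bQ _; rewrite ler_wpM2r// ge_min lexx orbT.
lra.
Qed.

(** A patch far below the mean would recur, by repetitivity, in every translate
of T n, and the volume of T m is a definite proportion of that of T n: this is
the dense gap excluded above.  The tiles are translates of the erosion of T m,
to which the continuity of w is applied.  The constant 72 leaves room for the
boundary errors of the passage from T m to its erosion and back to Lam. *)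
Lemma mean_lower (e : R) : weight_W5 mG d Lam w ->
  almost_tempered_repetitive d mG Lam T -> 0 < e ->
  exists N, forall m k, (N <= m)%N -> (Im - e) * v (T m) <= w (T m) (orb k).
Proof.
move=> W5 rep e0; have [Im_bound leI nearI] := mean_data.
case: (wQC) => cQ Q1 C1 [wl ws wt] _.
have C0 : 0 < C by lra.
pose V := unit_ball d.
have cV : compact V := compact_unit_ball dG.
have V1 : V 1%g := unit_ball1 dG.
have [N0 [sE vE]] := strong_folner_erosion hG cV V1 sT.
have e8 : 0 < e / 8 by rewrite divr_gt0.
have [delta5 [delta50 [m5 d5]]] := W5 _ sE _ e8.
pose delta := Num.min delta5 2^-1.
have delta0 : 0 < delta by rewrite lt_min delta50 invr_gt0 ltr0n.
have delta1 : delta < 1 by rewrite gt_min invf_lt1// ltr1n orbT.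
have T0 := folner_vol_gt0 hG sT.
have zeta0 : 0 < zeta d mG Lam T delta by apply: rep; rewrite delta0.
have zrep := zeta_repetitive T0 zeta0.
set z := zeta d mG Lam T delta in zeta0 zrep.
have e2 : 0 < e / 2 by rewrite divr_gt0.
have z2 : 0 < z / 2 by rewrite divr_gt0.
have [K [beta [cK beta0 gap]]] := no_dense_gap hG scG haarG uniG sigma_finite_mG
  cQ Q1 C1 (fun K L => wl _ K L hull_self) (fun n K => ws n K _ hull_self)
  Im_bound leI nearI e2 z2.
(* The relative size allowed to boundaries and to what the erosion removes. *)
pose gamma := e / (72 * C).
have gamma0 : 0 < gamma by rewrite divr_gt0// mulr_gt0.
have gammaC : C * gamma = e / 72 by rewrite /gamma; field; lra.
have [N1 b1] := folner_boundary hG sT cV gamma0.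
have [N2 b2] := folner_boundary hG sT cQ gamma0.
have [N3 b3] := folner_boundary hG sE cQ gamma0.
have beta2 : 0 < beta / 2 by rewrite divr_gt0.
have [N4 b4] := folner_boundary hG sE cK beta2.
exists (N0 + m5 + N1 + N2 + N3 + N4)%N => m k mN.
have [mN0 [m1 [m2 [m3 [m4 m5N]]]]] : (N0 <= m /\ N1 <= m /\ N2 <= m /\
    N3 <= m - N0 /\ N4 <= m - N0 /\ m5 <= m - N0)%N by clear -mN; lia.
pose S := erosion V (T m).
have ES : erosion V (T (m - N0 + N0)%N) = S by rewrite subnK.
have {m1}b1 := b1 m m1.
have {m2}b2 := b2 m m2.
have {m3} := b3 (m - N0)%N m3; rewrite ES => {}b3.
have {m4} := b4 (m - N0)%N m4; rewrite ES => {}b4.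
have {}d5 Pi Phi : hull Lam Pi -> hull Lam Phi ->
    (measure_dist d (invset S) Pi Phi <= delta5%:E)%E ->
    `|w S Phi - w S Pi| <= e / 8 * v S.
  by move=> hPi hPhi; have := d5 (m - N0)%N m5N; rewrite ES; apply.
have rS : relcompact_borel S by apply: RK_compact => //; exact: (compact_erosion hG V1 sT).
have vS2 : v (T m) <= 2 * v S by exact: vE.
have S0 : 0 < v S by rewrite -(pmulr_rgt0 _ (@ltr0Sn R 1)); exact: lt_le_trans (T0 m) vS2.
have ST : S `<=` T m by exact: erosion_sub.
have vST := vol_erosion mG hG cV V1 (rT m) rS.
have vTS : v (T m `\` S) = v (T m) - v S.
  exact: (vol_setD_sub (RK_finite mG hG (rT m)) rS.2 ST).
rewrite leNgt; apply/negP => low.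
have [n [rn zn]] := zrep m.
have cTn := folner_compact sT (m := n).
have Tn1 : T n 1%g by case: sT => _ _ /(_ n)[].
apply: (gap S (T n) rS cTn Tn1 S0).
- by apply: le_lt_trans b4 _; rewrite ltr_pM2r// gtr_pMr// invf_lt1// ltr1n.
- by rewrite mulrAC ler_pdivrMr// (mulrC (v S)); exact: le_trans zn vS2.
move=> h; have [c [Sc dc]] := repetitive_measure_dist dG k h (ltW delta1) rn.
exists c; split=> //.
have /ler_normlP[l1 _] := wl _ S (T m) (@hull_orbit k) rS (rT m) ST.
have /ler_normlP[_ l2] : `|w S (orb c) - w S (orb k)| <= e / 8 * v S.
  apply: d5; [exact: hull_orbit|exact: hull_orbit|].
  by apply: le_trans dc _; rewrite lee_fin ge_min lexx.
have /ler_normlP[l3 _] := weight_translate c rS.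
have st : v S <= v (T m) by rewrite -subr_ge0 -vTS vol_ge0.
rewrite vTS in l1.
exact: (lower_arithmetic C0 gamma0 gammaC vS2 (ltW S0) st vST b1 b2 b3 (ltW e0)
  Im_bound (ltW low) l1 l2 l3).
Qed.

Lemma hull_orbit_weight (e : R) : weight_W5 mG d Lam w -> 0 < e ->
  exists N, forall m Pi, (N <= m)%N -> hull Lam Pi ->
    exists k, `|w (T m) Pi - w (T m) (orb k)| <= e * v (T m).
Proof.
move=> W5 e0; have [delta [delta0 [N dN]]] := W5 _ sT _ e0.
exists N => m Pi Nm hPi.
have cTm := compact_invset (folner_compact sT (m := m)).
have [k dk] := hull_measure_dist hG dG hPi cTm delta0.
exists k; rewrite distrC; apply: dN => //; exact: hull_orbit.
Qed.

End limit.
End admissible_weights.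

Theorem theorem3p1 (R : realType) (G : topologicalGroupType)
    (mG : radonMeasure R G) (d : G -> G -> R) (Lam : weightedDelone R G)
    (w : set G -> radonMeasure R G -> R) :
  lcsc G -> haar mG -> unimodular mG -> amenable mG ->
  continuous_adapted_metric d ->
  admissible mG d Lam w ->
  exists I_w : R, forall T : nat -> set G,
    strong_folner_exhaustion mG T ->
    almost_tempered_repetitive d mG Lam T ->
    ereal_sup [set `|w (T m) Pi / vol mG (T m) - I_w|%:E | Pi in hull Lam]
      @[m --> \oo] --> 0%E.
Proof.
move=> [hG _ scG] haarG uniG _ dG wadm.
have [Q [C wQC]] := admissible_controlled hG wadm.
exists (asymptotic_mean mG (fun A => w A (dirac_comb Lam))) => T sT rep.
set Im := asymptotic_mean _ _.
have W5 : weight_W5 mG d Lam w by case: wadm.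
pose s m := ereal_sup [set `|w (T m) Pi / vol mG (T m) - Im|%:E | Pi in hull Lam].
have s0 m : (0 <= s m)%E.
  apply: (@le_trans _ _ (`|w (T m) (dirac_comb Lam) / vol mG (T m) - Im|%:E)).
    by rewrite lee_fin.
  by apply: ereal_sup_ubound; exists (dirac_comb Lam) => //; exact: hull_self.
have sle (e : R) : 0 < e -> exists N, forall m, (N <= m)%N -> (s m <= e%:E)%E.
  move=> e0; have e2 : 0 < e / 2 by rewrite divr_gt0.
  have [N1 up] := mean_upper hG uniG wQC sT e2.
  have [N2 low] := mean_lower hG scG haarG uniG dG wQC sT W5 rep e2.
  have [N3 app] := hull_orbit_weight hG dG sT W5 e2.
  exists (N1 + N2 + N3)%N => m Nm; apply: ge_ereal_sup => _ [Pi hPi <-].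
  rewrite lee_fin; have [|k /ler_normlP[a1 a2]] := app m Pi _ hPi; first by lia.
  have u : w (T m) (dirac_comb (wd_translate k Lam)) <= (Im + e / 2) * vol mG (T m).
    by apply: up; lia.
  have l : (Im - e / 2) * vol mG (T m) <= w (T m) (dirac_comb (wd_translate k Lam)).
    by apply: low; lia.
  have v0 : 0 < vol mG (T m) := folner_vol_gt0 hG sT m.
  rewrite ler_distl; apply/andP; split.
    by rewrite ler_pdivlMr//; lra.
  by rewrite ler_pdivrMr//; lra.
have sfin m (e : R) : (s m <= e%:E)%E -> s m \is a fin_num.
  by move=> sm; rewrite (ge0_fin_numE (s0 m)); exact: le_lt_trans sm (ltry _).
apply/fine_cvgP; split.
  by have [N sN] := sle 1 ltr01; exists N => // m /= /sN; exact: sfin.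
apply/cvg0P => e /sle[N sN]; exists N => m /sN sm.
by rewrite /= ger0_norm ?(fine_ge0 (s0 m))// -lee_fin fineK//; exact: sfin sm.
Qed.
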